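(* Let $\xi<\omega_1$. A normalized weakly null sequence in $C(\omega^{\omega^\xi})$ admits an unconditional subsequence if, and only if, it admits a subsequence which is $S_\xi$-unconditional.
   Context: $C(\alpha)$ denotes the Banach space of scalar valued continuous functions on the ordinal interval $[1,\alpha]$ with the order topology. Schreier families: to every countable ordinal $\alpha\ge 1$ a sequence of successor ordinals $(\alpha_n+1)_n$ is associated once and for all: if $\alpha$ is a successor, $\alpha_n=\alpha-1$ for all $n$; if $\alpha$ is a limit, $(\alpha_n+1)$ is a (fixed) strictly increasing sequence of ordinals tending to $\alpha$. For finite sets, $E<F$ means $\max E<\min F$. For families $\mathcal{F}_1,\mathcal{F}_2$ of finite subsets of $\mathbb{N}$, $\mathcal{F}_2[\mathcal{F}_1]=\{\bigcup_{i=1}^nG_i: n\in\mathbb{N},\ G_1<\dots<G_n,\ G_i\in\mathcal{F}_1\ \forall i\le n,\ \{\min G_i: i\le n\}\in\mathcal{F}_2\}\cup\{\emptyset\}$. Set $S_0=\{\{n\}:n\in\mathbb{N}\}\cup\{\emptyset\}$, $S_1=\{F\subset\mathbb{N}:|F|\le\min F\}\cup\{\emptyset\}$, $S_{\zeta+1}=S_1[S_\zeta]$, and for $\xi$ a limit ordinal $S_\xi=\bigcup_n\{F\in S_{\xi_n+1}: n\le\min F\}\cup\{\emptyset\}$. A normalized (Schauder) basic sequence $(x_n)$ in a Banach space is $S_\xi$-unconditional if there is a constant $C>0$ such that $\|\sum_{n\in F}a_nx_n\|\le C\|\sum_n a_nx_n\|$ for every $F\in S_\xi$ and every finitely supported scalar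 sequence $(a_n)$. *)

(* Defs.v *)
From HB Require Import structures.
From mathcomp Require Import all_boot all_order all_algebra finmap.
From mathcomp Require Import complex.
From mathcomp Require Import all_classical all_reals all_analysis.
From mathcomp Require Import wochoice.
Import Order.TTheory GRing.Theory Num.Theory.
Import numFieldNormedType.Exports.

Set Implicit Arguments.
Unset Strict Implicit.
Unset Printing Implicit Defensive.

Local Open Scope classical_set_scope.
Local Open Scope ring_scope.

(* omega_1 is realized as the initial segment, consisting of the elements with
   countably many predecessors, of a well-ordering of the power set of nat.
   Its elements are the countable ordinals. *)
Definition wo_le : rel (set nat) := sval (well_ordering_principle (set nat)).

Definition omega1 : Type :=
  {y : set nat | `[< countable [set z | wo_le z y] >]}.

HB.instance Definition _ := SubChoice.on omega1.

Fact ord_display : Order.disp_t. Proof. exact: Order.Disp tt tt. Qed.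

Lemma wo_leP : well_order wo_le.
Proof. exact: svalP. Qed.

Lemma wo_le_chain : wo_chain wo_le predT.
Proof. by move=> A _; exact: wo_leP. Qed.

Lemma wo_le_total : total wo_le.
Proof. by move=> x y; exact: (wo_chainW wo_le_chain). Qed.

Lemma wo_le_refl : reflexive wo_le.
Proof. by move=> x; exact: (wo_chain_reflexive wo_le_chain). Qed.

Lemma wo_le_anti : antisymmetric wo_le.
Proof. by move=> x y; exact: (wo_chain_antisymmetric wo_le_chain). Qed.

Lemma wo_le_least (A : set (set nat)) : A !=set0 ->
  exists2 z, A z & forall x, A x -> wo_le z x.
Proof.
move=> [a Aa]; have /wo_leP[z [[Az zA] _]] : wochoice.nonempty (mem A).
  by exists a; rewrite inE.
by exists z => [|x Ax]; [move: Az; rewrite inE|apply: zA; rewrite inE].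
Qed.

Lemma wo_le_trans : transitive wo_le.
Proof.
move=> y x z xy yz.
have [|t] := @wo_le_least [set x; y; z]; first by exists x; left; left.
move=> [[]|] -> h.
- by apply: h; right.
- suff -> : x = y by [].
  by apply: wo_le_anti; rewrite xy h //; left; left.
- suff <- : y = z by [].
  by apply: wo_le_anti; rewrite yz h //; left; right.
Qed.

Definition ord_le : rel omega1 := fun x y => wo_le (val x) (val y).
Definition ord_lt : rel omega1 := fun x y => (y != x) && ord_le x y.

Lemma ord_le_refl : reflexive ord_le.
Proof. by move=> x; exact: wo_le_refl. Qed.

Lemma ord_le_anti : antisymmetric ord_le.
Proof. by move=> x y /wo_le_anti/val_inj. Qed.

Lemma ord_le_trans : transitive ord_le.
Proof. by move=> x y z; exact: wo_le_trans. Qed.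

Lemma ord_le_total : total ord_le.
Proof. by move=> x y; exact: wo_le_total. Qed.

HB.instance Definition _ := @Order.isPOrder.Build ord_display omega1
  ord_le ord_lt (fun _ _ => erefl) ord_le_refl ord_le_anti ord_le_trans.
HB.instance Definition _ :=
  Order.POrder_isTotal.Build ord_display omega1 ord_le_total.

Lemma ord_least (A : set omega1) : A !=set0 -> exists2 z, A z & lbound A z.
Proof.
move=> [a Aa]; have [|_ [z Az <-] h] := @wo_le_least (val @` A).
  by exists (val a), a.
by exists z => // x Ax; apply: h; exists x.
Qed.

Lemma ord_wf : well_founded (fun x y : omega1 => (x < y)%O).
Proof.
move=> x; apply: contrapT => xN.
have [|z zN zP] := @ord_least (fun x => ~ Acc (fun x y => (x < y)%O) x).
  by exists x.
apply: zN; constructor => y yz; apply: contrapT => /zP.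
by rewrite leNgt yz.
Qed.

Lemma ord_segment_countable (x : omega1) : countable [set y | (y <= x)%O].
Proof.
case/countable_injP: (asboolP _ (valP x)) => f finj.
apply/countable_injP; exists (f \o val) => y z; rewrite !inE /= => yx zx fyz.
by apply/val_inj/finj; rewrite ?inE.
Qed.

Lemma countable_setU (T : Type) (A B : set T) :
  countable A -> countable B -> countable (A `|` B).
Proof.
move=> cA cB; apply: (@sub_countable _ _ _
    (\bigcup_(b in [set: bool]) (if b then A else B))).
  by apply: subset_card_le => x [Ax|Bx]; [exists true|exists false].
by apply: bigcup_countable => // -[].
Qed.

Lemma omega1_uncountable : ~ countable [set: omega1].
Proof.
move=> cO.
have cV : countable (val @` [set: omega1]) by exact: sub_countable (card_image_le _ _) cO.
have [[y yN]|/forallNP yP] := pselect (exists y, ~ (val @` [set: omega1]) y).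
  have [|z zN zP] := @wo_le_least (~` (val @` [set: omega1])); first by exists y.
  apply: zN; suff zc : `[< countable [set t | wo_le t z] >].
    by exists (Sub z zc).
  apply/asboolP; apply: (@sub_countable _ _ _ ((val @` [set: omega1]) `|` [set z])).
    apply: subset_card_le => t /= tz; apply: contrapT => /not_orP[tN tnz].
    by apply: tnz; apply: wo_le_anti; rewrite tz zP.
  exact: countable_setU.
have : countable [set: set nat].
  apply: sub_countable cV; apply: subset_card_le => y _.
  exact: (contrapT (yP y)).
move=> /countable_injP[f finj].
pose D := [set n | exists A : set nat, f A = n /\ ~ A n].
have DP : D (f D) <-> ~ D (f D).
  split=> [[A [AD ADN]]|DN]; last by exists D.
  have AeqD : A = D by apply: finj; rewrite ?inE.
  by rewrite AeqD in ADN.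
by move: DP; tauto.
Qed.

(* Countable sets of countable ordinals are bounded. *)
Lemma ord_bounded (A : set omega1) : countable A ->
  exists x, forall y, A y -> (y < x)%O.
Proof.
move=> cA; apply: contrapT => /forallNP h; apply: omega1_uncountable.
apply: (@sub_countable _ _ _ (\bigcup_(x in A) [set y | (y <= x)%O])).
  apply: subset_card_le => x _; apply: contrapT => xN; apply: (h x) => y Ay.
  by rewrite ltNge; apply/negP => xy; apply: xN; exists y.
by apply: bigcup_countable => // x _; exact: ord_segment_countable.
Qed.

Definition ozero : omega1 :=
  sval (cid (let: ex_intro x _ := ord_bounded (countable0 omega1) in
             let: ex_intro2 z _ zP := ord_least (ex_intro setT x I) in
             ex_intro (lbound [set: omega1]) z zP)).

Lemma ozero_le (x : omega1) : (ozero <= x)%O.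
Proof. by rewrite /ozero; case: cid => z /= zP; exact: zP. Qed.

(* ordinal successor: the least strictly larger element *)
Definition osucc (x : omega1) : omega1 :=
  xget ozero [set y | (x < y)%O /\ forall z, (x < z)%O -> (y <= z)%O].

Lemma osuccP (x : omega1) :
  (x < osucc x)%O /\ forall z, (x < z)%O -> (osucc x <= z)%O.
Proof.
rewrite /osucc; case: xgetP => [y _ //|N]; exfalso.
have [y yP] := ord_bounded (countable1 x).
have [|z xz zP] := @ord_least [set y | (x < y)%O]; first by exists y; exact: yP.
by apply: (N z); split.
Qed.

Lemma ltoS (x : omega1) : (x < osucc x)%O.
Proof. by case: (osuccP x). Qed.

Lemma leSo (x y : omega1) : (osucc x <= y)%O = (x < y)%O.
Proof.
apply/idP/idP => [|/(osuccP x).2 //]; exact: lt_le_trans (ltoS x).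
Qed.

Lemma ltSo (x y : omega1) : (x < osucc y)%O = (x <= y)%O.
Proof. by rewrite ltNge leSo -leNgt. Qed.

Lemma osucc_inj : injective osucc.
Proof.
by move=> x y xy; apply/le_anti; rewrite -!ltSo -xy ltoS /= xy ltoS.
Qed.

Definition oone : omega1 := osucc ozero.

Definition is_limit (a : omega1) : Prop :=
  a <> ozero /\ forall b, a <> osucc b.

Lemma osucc_neq0 (x : omega1) : osucc x <> ozero.
Proof. by move=> h; have := ltoS x; rewrite h ltNge ozero_le. Qed.

Lemma osup_supremums (A : set omega1) : A !=set0 -> countable A ->
  supremums A (supremum ozero A).
Proof.
move=> A0 cA; rewrite /supremum ifF; last by apply/negbTE/set0P.
case: xgetP => [y -> //|N]; exfalso.
have [x xP] := ord_bounded cA.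
have [|z zA zP] := @ord_least (ubound A); first by exists x => y /xP/ltW.
exact: (N z).
Qed.

Section transfinite_recursion.
Variables (T : Type) (z : T) (s : T -> T) (l : omega1 -> (omega1 -> T) -> T).

Let step (b : omega1) (rec : forall c, (c < b)%O -> T) : T :=
  let r c := if pselect (c < b)%O is left h then rec c h else z in
  if pselect (b = ozero) then z else
  if pselect (exists c, b = osucc c) is left h then s (r (sval (cid h)))
  else l b r.

(* The function with value z at 0 and s (f b) at b + 1; its value at a limit
   ordinal a is computed by l a from the restriction of f to the ordinals
   below a (extended by z). *)
Definition trec : omega1 -> T := Fix ord_wf (fun _ => T) step.

Let trecE b : trec b = step (fun c (_ : (c < b)%O) => trec c).
Proof.
apply: (Fix_eq ord_wf (fun _ => T) step) => x f g fg.
suff -> : f = g by [].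
apply: functional_extensionality_dep => c.
by apply: functional_extensionality_dep => h; exact: fg.
Qed.

Lemma trec0 : trec ozero = z.
Proof. by rewrite trecE /step; case: pselect. Qed.

Lemma trecS b : trec (osucc b) = s (trec b).
Proof.
rewrite trecE /step; case: (pselect (_ = ozero)) => [/osucc_neq0//|? /=].
case: (pselect (exists c, _)) => [h|]; last by case; exists b.
case: (cid h) => c /= /osucc_inj <-; case: pselect => // /negP.
by rewrite ltoS.
Qed.

Lemma trecL a : is_limit a ->
  trec a = l a (fun c => if (c < a)%O then trec c else z).
Proof.
move=> [a0 aS]; rewrite trecE /step; case: (pselect (_ = ozero)) => // ? /=.
case: (pselect (exists c, _)) => [[c /aS//]|? /=]; congr l; apply/funext => c.
by case: pselect => [-> //|/negP/negbTE -> ].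
Qed.

End transfinite_recursion.

Definition oiter (z : omega1) (s : omega1 -> omega1) : omega1 -> omega1 :=
  trec z s (fun a f => supremum ozero (f @` [set c | (c < a)%O])).

Definition oadd (a b : omega1) : omega1 := oiter a osucc b.
Definition omul (a b : omega1) : omega1 := oiter ozero (fun x => oadd x a) b.
(* correct for a >= 1 only; it is used with a = omega *)
Definition oexp (a b : omega1) : omega1 := oiter oone (fun x => omul x a) b.

Definition omega : omega1 :=
  supremum ozero (range (fun n => iter n osucc ozero)).

Lemma oiterL (z : omega1) (s : omega1 -> omega1) (a : omega1) : is_limit a ->
  oiter z s a = supremum ozero (oiter z s @` [set c | (c < a)%O]).
Proof.
move=> la; rewrite /oiter trecL //; congr supremum.
by apply/seteqP; split => _ [c /= ca <-]; exists c => //; rewrite ca.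
Qed.

(* A fixed choice of the sequences (a_n + 1)_{n >= 1} used to define the
   Schreier families; lad a n stands for a_{n+1}. *)
Definition ladder_system (lad : omega1 -> nat -> omega1) : Prop :=
  (forall b n, lad (osucc b) n = b) /\
  (forall a, is_limit a ->
    (forall m n, (m < n)%N -> (osucc (lad a m) < osucc (lad a n))%O) /\
    supremums (range (fun n => osucc (lad a n))) a).

(* Families of finite subsets of {1, 2, 3, ...}, encoded as sets of
   finite subsets of nat none of which contains 0. *)
Definition fin_family := set {fset nat}.

(* used only for nonempty F *)
Definition fmin (F : {fset nat}) : nat := head 0%N (sort leq F).
Definition fmax (F : {fset nat}) : nat := (\max_(i <- F) i)%N.

Definition block_lt : rel {fset nat} := fun E F => (fmax E < fmin F)%N.

Definition family_comp (F2 F1 : fin_family) : fin_family :=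
  [set F | exists G : seq {fset nat},
     [/\ sorted block_lt G,
         (forall g, g \in G -> g != fset0 /\ F1 g),
         F2 [fset fmin g | g in G]%fset
       & F = (\bigcup_(g <- G) g)%fset]]
  `|` [set fset0].

Definition schreier_zero : fin_family :=
  [set F | exists2 n, (0 < n)%N & F = [fset n]%fset] `|` [set fset0].

Definition schreier_one : fin_family :=
  [set F | (#|` F| <= fmin F)%N] `|` [set fset0].

Definition schreier (lad : omega1 -> nat -> omega1) : omega1 -> fin_family :=
  trec schreier_zero (family_comp schreier_one)
    (fun a S => [set F | exists n, S (osucc (lad a n)) F /\ (n.+1 <= fmin F)%N]
                `|` [set fset0]).

Lemma schreier0 lad : schreier lad ozero = schreier_zero.
Proof. exact: trec0. Qed.

Lemma schreierS lad b :
  schreier lad (osucc b) = family_comp schreier_one (schreier lad b).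
Proof. exact: trecS. Qed.

Lemma schreierL lad a : ladder_system lad -> is_limit a ->
  schreier lad a =
  [set F | exists n, schreier lad (osucc (lad a n)) F /\ (n.+1 <= fmin F)%N]
  `|` [set fset0].
Proof.
move=> [_ hlad] la; rewrite /schreier trecL //; congr (_ `|` _).
have [linc [lub _]] := hlad _ la.
apply/seteqP; split=> F /= [n [h1 h2]]; exists n; split => //; move: h1;
  by rewrite (lt_le_trans (linc n n.+1 (ltnSn n)))//; apply: lub; exists n.+1.
Qed.

(* The ordinal interval [1, a]. *)
Definition ordint (a : omega1) : Type :=
  {b : omega1 | (oone <= b <= a)%O}.

HB.instance Definition _ (a : omega1) := SubChoice.on (ordint a).
HB.instance Definition _ (a : omega1) :=
  [SubChoice_isSubOrder of ordint a by <: with ord_display].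

Lemma ordint_compact (a : omega1) : compact [set: order_topology (ordint a)].
Proof.
move=> F PF FT.
have leE (x y : order_topology (ordint a)) :
  (x <= y)%O = (val (x : ordint a) <= val (y : ordint a))%O by exact: leEsub.
have [[t _]|h] := pselect ([set: order_topology (ordint a)] !=set0); last first.
  exfalso; apply: (@filter_not_empty _ F).
  by apply: filterS FT => x _; apply: h; exists x.
have aP : (oone <= a <= a)%O.
  by case/andP: (valP t) => h1 h2; rewrite lexx (le_trans h1 h2).
pose top : order_topology (ordint a) := Sub a aP.
pose B : set omega1 :=
  [set b | exists2 x : order_topology (ordint a), b = val x & F [set y | (y <= x)%O]].
have [|_ [b -> Fb] bmin] := @ord_least B.
  exists a, top => //; apply: filterS FT => y _ /=.
  by rewrite leE; case/andP: (valP y).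
exists b; split => // S U FS; rewrite itv_nbhsE => -[i [io bi] iU].
have FSb : F (S `&` [set y | (y <= b)%O]) by exact: filterI.
have FN x : (x < b)%O -> ~ F [set y | (y <= x)%O].
  move=> xb Fx; have /bmin : B (val x) by exists x.
  by rewrite -leE leNgt xb.
have key (A : set (order_topology (ordint a))) : (forall y, (y <= b)%O -> A y) -> S `&` A !=set0.
  move=> bA; have [y [Sy yb]] := filter_ex FSb.
  by exists y; split => //; exact: bA.
have key2 x (A : set (order_topology (ordint a))) : (x < b)%O ->
    (forall y, (x < y)%O -> (y <= b)%O -> A y) -> S `&` A !=set0.
  move=> xb bA; apply: contrapT => SA; apply: (FN x xb).
  apply: filterS FSb => y [Sy yb] /=; rewrite leNgt; apply/negP => xy.
  by apply: SA; exists y; split => //; exact: bA.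
suff [y [Sy yi]] : S `&` [set` i] !=set0 by exists y; split => //; exact: iU.
case: i io bi {iU} => [[[] l|[]] [[] r|[]]] //= _; rewrite in_itv /= ?andbT.
- move=> /andP[lb br]; apply: (key2 l) => // y ly yb.
  by rewrite /= in_itv /= ly (le_lt_trans yb br).
- by move=> lb; apply: (key2 l) => // y ly yb; rewrite /= in_itv /= ly.
- by move=> br; apply: key => y yb; rewrite /= in_itv /= (le_lt_trans yb br).
- by move=> _; apply: key => y yb; rewrite /= in_itv.
Qed.

Section continuous_functions.
Variables (K : numFieldType) (X : topologicalType).
Implicit Types f g : continuousType X K^o.


Lemma cts_zero_subproof : continuous (fun _ : X => 0 : K^o).
Proof. by move=> x; exact: cvg_cst. Qed.

Lemma cts_opp_subproof f : continuous (fun x => - f x : K^o).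
Proof. by move=> x; apply: cvgN; exact: cts_fun. Qed.

Lemma cts_add_subproof f g : continuous (fun x => f x + g x : K^o).
Proof. by move=> x; apply: cvgD; exact: cts_fun. Qed.

Lemma cts_scale_subproof (k : K) f : continuous (fun x => k *: f x : K^o).
Proof. by move=> x; apply: cvgZr; exact: cts_fun. Qed.

Definition cts_zero : continuousType X K^o := mkcts cts_zero_subproof.
Definition cts_opp f : continuousType X K^o := mkcts (@cts_opp_subproof f).
Definition cts_add f g : continuousType X K^o := mkcts (@cts_add_subproof f g).
Definition cts_scale k f : continuousType X K^o :=
  mkcts (@cts_scale_subproof k f).

Lemma cts_addA : associative cts_add.
Proof. by move=> f g h; apply/continuousEP => x; exact: addrA. Qed.

Lemma cts_addC : commutative cts_add.
Proof. by move=> f g; apply/continuousEP => x; exact: addrC. Qed.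

Lemma cts_add0 : left_id cts_zero cts_add.
Proof. by move=> f; apply/continuousEP => x; exact: add0r. Qed.

Lemma cts_addN : left_inverse cts_zero cts_opp cts_add.
Proof. by move=> f; apply/continuousEP => x; exact: addNr. Qed.

Lemma cts_scaleA a b f : cts_scale a (cts_scale b f) = cts_scale (a * b) f.
Proof. by apply/continuousEP => x; exact: scalerA. Qed.

Lemma cts_scale1 : left_id 1 cts_scale.
Proof. by move=> f; apply/continuousEP => x; exact: scale1r. Qed.

Lemma cts_scaleDr : right_distributive cts_scale cts_add.
Proof. by move=> k f g; apply/continuousEP => x; exact: scalerDr. Qed.

Lemma cts_scaleDl f :
  {morph cts_scale^~ f : a b / a + b >-> cts_add a b}.
Proof. by move=> a b; apply/continuousEP => x; exact: scalerDl. Qed.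

Definition sup_norm f : K := supremum 0 (range (fun x => `|f x|)).

(* The supremum is a maximum; K is not assumed to be totally ordered. *)
Lemma sup_normP f : compact [set: X] -> [set: X] !=set0 ->
  exists2 x, sup_norm f = `|f x| & forall y, `|f y| <= `|f x|.
Proof.
move=> cX [x0 _].
have cmp (x y : X) : `|f x| >=< `|f y| by apply: real_comparable; exact: normr_real.
pose F := filter_from [set: X] (fun x => [set y | `|f x| <= `|f y|]).
have PF : ProperFilter F.
  apply: filter_from_proper; last by move=> x _; exists x => /=.
  apply: filter_from_filter; first by exists x0.
  move=> x y _ _; have [xy|yx] := orP (cmp x y).
    by exists y => // z /= yz; split => //; exact: le_trans yz.
  by exists x => // z /= xz; split => //; exact: le_trans xz.
have [|p [_ pP]] := cX F PF; first by exists x0.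
have pmax y : `|f y| <= `|f p|.
  apply: contrapT => ypN; have py : `|f p| < `|f y|.
    by rewrite real_ltNge ?normr_real//; exact/negP.
  have [||z [/= yz zy]] := pP [set z | `|f y| <= `|f z|] [set z | `|f z| < `|f y|].
  - by exists y.
  - have /cvgrPdist_lt/(_ (`|f y| - `|f p|)) := @cts_fun _ _ f p.
    rewrite subr_gt0 => /(_ py); apply: filterS => z /= fpz.
    rewrite -(subrK (f p) (f z)) (le_lt_trans (ler_normD _ _))//.
    by rewrite -ltrBrDr distrC.
  - by have := le_lt_trans yz zy; rewrite ltxx.
exists p => //; rewrite /sup_norm /supremum ifF; last first.
  by apply/negbTE/set0P; exists `|f x0|, x0.
apply: (@is_subset1_supremums _ _ (range (fun x => `|f x|))).
  case: xgetP => [y _ //|/(_ `|f p|) N]; exfalso; apply: N.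
  by split => [_ [y _ <-]//|y]; apply; exists p.
by split => [_ [y _ <-]//|y]; apply; exists p.
Qed.

Lemma sup_norm_empty f : ~ ([set: X] !=set0) -> sup_norm f = 0.
Proof.
move=> X0; rewrite /sup_norm.
suff -> : range (fun x => `|f x|) = set0 by rewrite supremum0.
by apply/seteqP; split => // y [x _ _]; apply: X0; exists x.
Qed.

Lemma sup_normD f g : compact [set: X] ->
  sup_norm (cts_add f g) <= sup_norm f + sup_norm g.
Proof.
move=> cX; have [X0|X0] := pselect ([set: X] !=set0); last first.
  by rewrite !sup_norm_empty// addr0.
have [x -> _] := sup_normP (cts_add f g) cX X0.
have [y -> yP] := sup_normP f cX X0.
have [z -> zP] := sup_normP g cX X0.
by rewrite (le_trans (ler_normD _ _))// lerD.
Qed.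

Lemma sup_normZ k f : compact [set: X] ->
  sup_norm (cts_scale k f) = `|k| * sup_norm f.
Proof.
move=> cX; have [X0|X0] := pselect ([set: X] !=set0); last first.
  by rewrite !sup_norm_empty// mulr0.
have [x -> xP] := sup_normP (cts_scale k f) cX X0.
have [y -> yP] := sup_normP f cX X0.
apply/le_anti/andP; split.
  by rewrite /= normrZ ler_wpM2l.
by rewrite -normrM; exact: xP.
Qed.

Lemma sup_norm_eq0 f : compact [set: X] -> sup_norm f = 0 -> f = cts_zero.
Proof.
move=> cX f0; apply/continuousEP => x /=.
have [y fy yP] := sup_normP f cX (ex_intro _ x I).
by apply/normr0_eq0/le_anti; rewrite normr_ge0 andbT -f0 fy yP.
Qed.

End continuous_functions.

(* The space C(a) of scalar-valued continuous functions on [1, a] with the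
   order topology, under the supremum norm. *)
Definition Cspace (K : numFieldType) (a : omega1) : Type :=
  continuousType (order_topology (ordint a)) K^o.

Section Cspace.
Variables (K : numFieldType) (a : omega1).

HB.instance Definition _ := Choice.on (Cspace K a).
HB.instance Definition _ := GRing.isZmodule.Build (Cspace K a)
  (@cts_addA _ _) (@cts_addC _ _) (@cts_add0 _ _) (@cts_addN _ _).
HB.instance Definition _ := GRing.Zmodule_isLmodule.Build K (Cspace K a)
  (@cts_scaleA _ _) (@cts_scale1 _ _) (@cts_scaleDr _ _) (@cts_scaleDl _ _).
HB.instance Definition _ := Lmodule_isNormed.Build K (Cspace K a)
  (fun f g => sup_normD f g (@ordint_compact a))
  (fun k f => sup_normZ k f (@ordint_compact a))
  (fun f => sup_norm_eq0 (@ordint_compact a)).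

End Cspace.

(* The scalar field is R or C. *)
Variant scalar_kind := RealScalars | ComplexScalars.

Definition scalars (R : realType) (k : scalar_kind) : numFieldType :=
  match k with RealScalars => R | ComplexScalars => R[i] end.

Section sequences_in_normed_spaces.
Variables (K : numFieldType) (V : normedModType K).
Implicit Types x : nat -> V.

(* Sequences are indexed from 0: x n stands for the (n+1)-st term. *)

Definition normalized x : Prop := forall n, `|x n| = 1.

Definition weakly_null x : Prop :=
  forall phi : {linear V -> K^o}, continuous phi ->
    phi (x n) @[n --> \oo] --> (0 : K^o).

Definition lin_span x : set V :=
  [set v | exists (n : nat) (a : nat -> K), v = \sum_(i < n) a i *: x i].

(* x is a Schauder basis of its closed linear span *)
Definition basic_seq x : Prop :=
  forall v, closure (lin_span x) v ->
    exists! a : nat -> K, series (fun n => a n *: x n) @ \oo --> v.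

Definition family_unconditional (S : fin_family) x : Prop :=
  [/\ normalized x, basic_seq x
    & exists2 C : K, 0 < C &
      forall (F : {fset nat}) (N : nat) (a : nat -> K),
        S [fset n.+1 | n in F]%fset ->
        (forall n, (N <= n)%N -> a n = 0) ->
        `|\sum_(n <- F) a n *: x n| <= C * `|\sum_(n < N) a n *: x n|].

Definition unconditional x : Prop := family_unconditional setT x.

Definition has_subseq (P : (nat -> V) -> Prop) x : Prop :=
  exists s : nat -> nat, {homo s : m n / (m < n)%N} /\ P (x \o s).

End sequences_in_normed_spaces.

(* Main.v *)
Require Import Defs.
From HB Require Import structures.
From mathcomp Require Import all_boot all_order all_algebra finmap.
From mathcomp Require Import all_classical all_reals all_analysis.
Import Order.TTheory GRing.Theory Num.Theory.
Import numFieldNormedType.Exports.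

Set Implicit Arguments.
Unset Strict Implicit.
Unset Printing Implicit Defensive.

(** Let (y_n) be S_xi-unconditional with constant C and pointwise null on
    K = [1, omega^(omega^xi)]. Since K is countable, a diagonal argument yields a
    subsequence (z_k) such that each t lies in only finitely many of the closed
    sets U_k = {|z_k| >= 2^-k}. The points of K other than its maximum have
    Cantor-Bendixson rank less than omega^xi, and a nonempty closed set attains
    its maximal rank at finitely many points only. Thinning out so that each new
    U_k misses those points for all intersections of the previous U_j, the
    maximal rank of the intersection of (U_k), k in A, strictly decreases when A
    is end-extended. An induction on xi then shows that, after a further
    thinning, A minus its first element belongs to S_xi (in the indices of y)
    whenever that intersection is nonempty. At a point t, the sum of a_k z_k(t)
    over k in F is therefore the sum of one term with t in U_k, a sum controlled
    by S_xi-unconditionality, and a remainder controlled by the sum of the 2^-k. *)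

Local Open Scope classical_set_scope.
Local Open Scope order_scope.

(** * Ordinal arithmetic and Cantor-Bendixson rank *)

Lemma ord_ind (P : omega1 -> Prop) :
  (forall a, (forall b, b < a -> P b) -> P a) -> forall a, P a.
Proof. by move=> h a; apply: (well_founded_ind ord_wf P). Qed.

Lemma ord_cases (a : omega1) :
  [\/ a = ozero, exists b, a = osucc b | is_limit a].
Proof.
have [->|a0] := pselect (a = ozero); first exact: Or31.
have [?|aS] := pselect (exists b, a = osucc b); first exact: Or32.
by apply: Or33; split => // b ab; apply: aS; exists b.
Qed.

Lemma ord_gt0 (a : omega1) : (ozero < a) = (a != ozero).
Proof. by rewrite lt_neqAle ozero_le andbT eq_sym. Qed.

Lemma limit_gt0 (a : omega1) : is_limit a -> ozero < a.
Proof. by move=> [/eqP a0 _]; rewrite ord_gt0. Qed.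

Lemma countable_below (a : omega1) : countable [set c | c < a].
Proof.
apply: sub_countable (ord_segment_countable a).
by apply: subset_card_le => c /= /ltW.
Qed.

Section oiter_theory.
Variables (z : omega1) (s : omega1 -> omega1).

Lemma oiter0 : oiter z s ozero = z.
Proof. exact: trec0. Qed.

Lemma oiterS b : oiter z s (osucc b) = s (oiter z s b).
Proof. exact: trecS. Qed.

Lemma oiter_limit_supremums a : is_limit a ->
  supremums (oiter z s @` [set c | c < a]) (oiter z s a).
Proof.
move=> la; rewrite oiterL//; apply: osup_supremums.
  by exists (oiter z s ozero), ozero => //=; exact: limit_gt0.
exact: sub_countable (card_image_le _ _) (countable_below a).
Qed.

Lemma oiter_limit_ltP a t : is_limit a -> t < oiter z s a ->
  exists2 c, c < a & t < oiter z s c.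
Proof.
move=> la ta; apply: contrapT => h.
have [_ /(_ t)] := oiter_limit_supremums la.
rewrite leNgt ta => /(_ _)/negP; apply; last by [].
move=> _ [c ca <-]; rewrite leNgt; apply/negP => tc; apply: h.
by exists c.
Qed.

Lemma oiter_le : (forall x, x <= s x) -> {homo oiter z s : a b / a <= b}.
Proof.
move=> xs a; elim/ord_ind => b IH; rewrite le_eqVlt => /orP[/eqP->//|ab].
have [b0|[c bc]|lb] := ord_cases b.
- by move: ab; rewrite b0 ltNge ozero_le.
- move: ab IH; rewrite bc ltSo => ac IH.
  by rewrite oiterS (le_trans _ (xs _))// IH// ltoS.
- by have [ub _] := oiter_limit_supremums lb; apply: ub; exists a.
Qed.

Lemma oiter_lt : (forall x, x < s x) -> {homo oiter z s : a b / a < b}.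
Proof.
move=> xs a b; rewrite -leSo => ab; apply: lt_le_trans (xs _) _.
by rewrite -oiterS; apply: oiter_le ab => x; exact: ltW.
Qed.

End oiter_theory.

Lemma oadd0 a : oadd a ozero = a. Proof. exact: oiter0. Qed.

Lemma oaddS a b : oadd a (osucc b) = osucc (oadd a b).
Proof. exact: oiterS. Qed.

Lemma oadd_lt a : {homo oadd a : b c / b < c}.
Proof. by apply: oiter_lt => x; exact: ltoS. Qed.

Lemma oadd_leE a : {mono oadd a : b c / b <= c}.
Proof. exact/le_mono/oadd_lt. Qed.

Lemma oadd_ltE a : {mono oadd a : b c / b < c}.
Proof. exact/leW_mono/oadd_leE. Qed.

Lemma le_oaddr a b : a <= oadd a b.
Proof. by rewrite -{1}(oadd0 a) oadd_leE ozero_le. Qed.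

Lemma le_oaddl a b : b <= oadd a b.
Proof.
elim/ord_ind: b => b IH; rewrite leNgt; apply/negP => h.
by have := IH _ h; rewrite oadd_leE leNgt h.
Qed.

Lemma oadd_subK a t : a <= t -> exists s, t = oadd a s.
Proof.
move=> at_; have [|s ts smin] := @ord_least [set s | t <= oadd a s].
  by exists t; exact: le_oaddl.
have lts c : c < s -> oadd a c < t.
  by move=> cs; rewrite ltNge; apply/negP => /smin; rewrite leNgt cs.
exists s; apply/le_anti; rewrite ts /=.
have [s0|[c sc]|ls] := ord_cases s.
- by rewrite s0 oadd0.
- by rewrite sc oaddS leSo lts// sc ltoS.
- have [_] := oiter_limit_supremums a osucc ls.
  by apply => _ [c /= cs <-]; exact/ltW/lts.
Qed.

(** By induction on [v]: a failure at [v] lets one subtract [c] and then [u] from [t], which gives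
    [t = oadd c (oadd u e)] with [e < v]; the case [e] then puts [t] strictly below itself. *)
Lemma oaddA_le c u v : oadd c (oadd u v) <= oadd (oadd c u) v.
Proof.
elim/ord_ind: v => v IH; rewrite leNgt; apply/negP; set t := oadd _ v => tl.
have [d td] := oadd_subK (le_trans (le_oaddr c u) (le_oaddr (oadd c u) v)).
move: tl; rewrite -/t in td; rewrite td oadd_ltE => duv.
have ud : u <= d by rewrite -(oadd_leE c) -td; exact: le_oaddr.
have [e de] := oadd_subK ud.
move: duv; rewrite de oadd_ltE => ev; have := IH _ ev.
by rewrite -de -td leNgt /t oadd_ltE ev.
Qed.

Lemma omega_supremums :
  supremums (range (fun n => iter n osucc ozero)) omega.
Proof.
apply: osup_supremums; first by exists ozero, 0%N.
exact: sub_countable (card_image_le _ _) (countableP _).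
Qed.

Lemma omega_ltP t : t < omega -> exists n, t < iter n osucc ozero.
Proof.
move=> tw; apply: contrapT => h; have [_ /(_ t)] := omega_supremums.
rewrite leNgt tw => H; suff // : false by [].
by apply: H => _ [n _ <-]; rewrite leNgt; apply/negP => tn; apply: h; exists n.
Qed.

Lemma iter_le_omega n : iter n osucc ozero <= omega.
Proof. by have [ub _] := omega_supremums; apply: ub; exists n. Qed.

Lemma omega_limit : is_limit omega.
Proof.
split=> [w0|b wb].
  have := iter_le_omega 1; rewrite w0 leNgt /= ltoS; exact/negP.
have [|n bn] := @omega_ltP b; first by rewrite wb ltoS.
have := iter_le_omega n.+1; rewrite wb /= leNgt => /negP; apply.
by rewrite ltSo leSo.
Qed.

Lemma omul_le x : {homo omul x : a b / a <= b}.
Proof. by apply: oiter_le => y; exact: le_oaddr. Qed.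

Lemma omulS x b : omul x (osucc b) = oadd (omul x b) x.
Proof. exact: oiterS. Qed.

Lemma omul0 x : omul x ozero = ozero. Proof. exact: oiter0. Qed.

Lemma omul_omega_ltP x t : t < omul x omega ->
  exists n, t < omul x (iter n osucc ozero).
Proof.
move=> /(oiter_limit_ltP omega_limit)[c cw tc].
have [n cn] := omega_ltP cw; exists n.
exact: lt_le_trans tc (omul_le _ (ltW cn)).
Qed.

Lemma le_omul_omega x : x <= omul x omega.
Proof.
apply: le_trans (omul_le x (iter_le_omega 1)).
by rewrite /= omulS omul0 le_oaddl.
Qed.

Lemma oexp0 a : oexp a ozero = oone. Proof. exact: oiter0. Qed.

Lemma oexpS a b : oexp a (osucc b) = omul (oexp a b) a.
Proof. exact: oiterS. Qed.

Lemma oexp_omega_le : {homo oexp omega : a b / a <= b}.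
Proof. by apply: oiter_le => y; exact: le_omul_omega. Qed.

Lemma oadd_le2r x : {homo oadd^~ x : u w / u <= w}.
Proof.
move=> u w uw; elim/ord_ind: x => x IH; rewrite leNgt; apply/negP => h.
have [d td] := oadd_subK (le_trans uw (le_oaddr w x)).
move: h; rewrite td oadd_ltE => dx; have := IH _ dx.
by rewrite -td leNgt oadd_ltE dx.
Qed.

(** Stated with iterates, the form over which [thins_blocks] inducts; the passage from finite
    multiples of [x] to iterates rests on [oaddA_le]. *)
Lemma oadd_omul_omega_ltP c x t : t < oadd c (omul x omega) ->
  exists n, t < iter n (oadd^~ x) c.
Proof.
have [tc _|ct] := ltP t c; first by exists 0%N.
have [d ->] := oadd_subK ct; rewrite oadd_ltE => /omul_omega_ltP[n dn].
exists n; apply: (@lt_le_trans _ _ (oadd c (omul x (iter n osucc ozero)))).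
  by rewrite oadd_ltE.
elim: n {dn} => [|n IH] /=; first by rewrite omul0 oadd0.
by rewrite omulS (le_trans (oaddA_le _ _ _))// oadd_le2r.
Qed.

(* The Cantor-Bendixson rank in the order topology; its value at 0 is the
   default ozero of xget. *)
Definition cb_rank : omega1 -> omega1 :=
  Fix ord_wf (fun _ => omega1) (fun t rec =>
    xget ozero [set g | lbound [set h | exists2 u, u < t &
        forall s (st : s < t), u < s -> rec s st < h] g
      /\ exists2 u, u < t & forall s (st : s < t), u < s -> rec s st < g]).

Lemma cb_rankE t : cb_rank t =
  xget ozero [set g | lbound [set h | exists2 u, u < t &
      forall s, s < t -> u < s -> cb_rank s < h] g
    /\ exists2 u, u < t & forall s, s < t -> u < s -> cb_rank s < g].
Proof.
rewrite /cb_rank Fix_eq// => x f g fg.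
suff -> : f = g by [].
apply: functional_extensionality_dep => c.
by apply: functional_extensionality_dep => h; exact: fg.
Qed.

Lemma cb_rankP t : ozero < t ->
  (exists2 u, u < t & forall s, u < s -> s < t -> cb_rank s < cb_rank t) /\
  forall g u, u < t -> (forall s, u < s -> s < t -> cb_rank s < g) ->
    cb_rank t <= g.
Proof.
move=> t0; rewrite [cb_rank t]cb_rankE; case: xgetP => [g _ [gP [u ut uP]]|N].
  split; first by exists u => // s us st; exact: uP.
  by move=> h v vt vP; apply: gP; exists v => // s st vs; exact: vP.
(* The ranks below [t] form a countable set; a strict bound [x] for them makes the set of admissible
   values nonempty. *)
exfalso; have [x xP] := @ord_bounded (cb_rank @` [set s | s < t])
  (sub_countable (card_image_le _ _) (countable_below t)).
have [|z zP zmin] := @ord_least [set h | exists2 u, u < t &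
      forall s, s < t -> u < s -> cb_rank s < h].
  by exists x, ozero => // s st _; apply: xP; exists s.
by apply: (N z).
Qed.

(** Left translation by [a] carries the left neighbourhood (u, s) onto (a + u, a + s), and by
    induction it does not raise ranks there. *)
Lemma cb_rank_oadd a s : ozero < s -> cb_rank (oadd a s) <= cb_rank s.
Proof.
elim/ord_ind: s => s IH s0; have [[u us uP] _] := cb_rankP s0.
have as0 : ozero < oadd a s by rewrite (lt_le_trans s0)// le_oaddl.
apply: ((cb_rankP as0).2 _ (oadd a u)); first by rewrite oadd_ltE.
move=> v uv; have [d vd] := oadd_subK (le_trans (le_oaddr a u) (ltW uv)).
move: uv; rewrite vd !oadd_ltE => ud ds.
have d0 : ozero < d by exact: le_lt_trans (ozero_le _) ud.
by rewrite (le_lt_trans (IH _ ds d0))// uP.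
Qed.

(** For a successor exponent, [s] lies in one of the consecutive blocks of length [oexp omega b].
    Translating the block back replaces [s] by some [d <= oexp omega b], and all positive points
    below [d] have rank less than [b] by induction. *)
Lemma cb_rank_oexp_omega a s :
  ozero < s -> s < oexp omega a -> cb_rank s < a.
Proof.
elim/ord_ind: a s => a IH s s0; have [->|[b ab]|la] := ord_cases a.
- by rewrite oexp0 ltSo leNgt s0.
- move: IH; rewrite ab oexpS ltSo => IH /omul_omega_ltP[n /ltW].
  elim: n s s0 => [|n IHn] s s0 /=; first by rewrite omul0 leNgt s0.
  rewrite omulS => sn.
  have [|ns] := leP s (omul (oexp omega b) (iter n osucc ozero)); first exact: IHn.
  have [d sd] := oadd_subK (ltW ns); move: sn ns; rewrite sd oadd_leE => db.
  rewrite -{1}(oadd0 (omul _ _)) oadd_ltE => d0.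
  rewrite (le_trans (cb_rank_oadd _ d0))//.
  apply: ((cb_rankP d0).2 _ ozero) => // u u0 ud.
  by apply: IH; rewrite ?ltoS// (lt_le_trans ud).
- move=> /(oiter_limit_ltP la)[c ca sc].
  exact: lt_trans (IH c ca s s0 sc) ca.
Qed.

(** * Diagonalization *)

Definition unbounded (M : set nat) : Prop :=
  forall n, exists2 m, (n < m)%N & M m.

(* In Q k n m, m is the candidate for s k and n the preceding value. *)
Lemma increasing_choice (Q : nat -> nat -> nat -> Prop) :
  (forall k n, exists2 m, (n < m)%N & Q k n m) ->
  exists s : nat -> nat, [/\ {homo s : m n / (m < n)%N},
    exists n, Q 0%N n (s 0%N) & forall k, Q k.+1 (s k) (s k.+1)].
Proof.
move=> h; have /choice[f fP] (kn : nat * nat) :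
    exists m, (kn.2 < m)%N /\ Q kn.1 kn.2 m.
  by have [m ? ?] := h kn.1 kn.2; exists m.
pose s := nat_rect (fun=> nat) (f (0, 0)%N) (fun k n => f (k.+1, n)).
exists s; split; last by move=> k; exact: (fP (k.+1, s k)).2.
- by apply: homo_ltn => [? ? ? |k]; [exact: ltn_trans|exact: (fP (k.+1, s k)).1].
- by exists 0%N; exact: (fP (0, 0)%N).2.
Qed.

Lemma leq_increasing (s : nat -> nat) k :
  {homo s : m n / (m < n)%N} -> (k <= s k)%N.
Proof. by move=> hs; elim: k => // k IH; apply: leq_ltn_trans IH (hs _ _ _). Qed.

Lemma unbounded_range (s : nat -> nat) :
  {homo s : m n / (m < n)%N} -> unbounded (range s).
Proof. by move=> hs n; exists (s n.+1); [exact: leq_increasing|exists n.+1]. Qed.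

Lemma unbounded_geq M n : unbounded M -> unbounded [set m | M m /\ (n <= m)%N].
Proof.
move=> uM j; have [m] := uM (maxn j n).
by rewrite gtn_max => /andP[jm nm] Mm; exists m => //; split => //; exact: ltnW.
Qed.

Section diagonalization.
Implicit Types Good : seq nat -> set nat -> Prop.

(** [Good B M] is read as: [M] is an acceptable supply of elements to follow the finite stem [B]. *)
Definition thinnable Good : Prop :=
  (forall B M M', M' `<=` M -> Good B M -> Good B M') /\
  (forall B N, unbounded N -> exists M, [/\ unbounded M, M `<=` N & Good B M]).

(** Only finitely many stems lie below a given bound. In the step to [k.+1], those that end in [k]
    are handled by the induction hypothesis for [fun B => Good (rcons B k)], after the others. *)
Lemma thin_bounded Good k N : thinnable Good -> unbounded N ->
  exists M, [/\ unbounded M, M `<=` N &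
    forall B, sorted ltn B -> (forall b, b \in B -> (b < k)%N) -> Good B M].
Proof.
elim: k Good N => [|k IH] Good N [Gsub Gex] uN.
  have [M [uM MN GM]] := Gex [::] N uN; exists M; split => // -[//|b B] _ h.
  by have := h b; rewrite mem_head => /(_ isT).
have [M [uM MN GM]] := IH Good N (conj Gsub Gex) uN.
have [|M' [uM' M'M GM']] := IH (fun B => Good (rcons B k)) M _ uM.
  by split => B; [exact: Gsub|exact: Gex].
exists M'; split => //; first exact: subset_trans M'M MN.
case/lastP=> [|B b] sB hB; first by apply: Gsub M'M _; exact: GM.
have hb : (b < k.+1)%N by apply: hB; rewrite mem_rcons mem_head.
have Bb c : c \in B -> (c < b)%N.
  move: sB; rewrite (sorted_pairwise ltn_trans) pairwise_rcons => /andP[/allP h _].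
  exact: h.
move: hb; rewrite ltnS leq_eqVlt => /orP[/eqP bk|bk].
  rewrite bk; apply: GM'; last by move=> c /Bb; rewrite bk.
  move: sB; rewrite !(sorted_pairwise ltn_trans) pairwise_rcons.
  by case/andP.
apply: Gsub M'M _; apply: GM => // c; rewrite mem_rcons inE => /orP[/eqP->//|].
by move/Bb => cb; exact: ltn_trans bk.
Qed.

(** Fusion: the sets [Ns k] decrease, [Ns k] is good for every stem below [k], and each new value of
    [s] is taken from [Ns] at the successor of the preceding value. What follows the last element of
    a stem therefore lies in a set that is good for this stem. *)
Lemma diagonal_thinning Good N : thinnable Good -> unbounded N ->
  exists M, [/\ unbounded M, M `<=` N &
    forall B, sorted ltn B -> (forall b, b \in B -> M b) ->
      Good B [set m | M m /\ forall b, b \in B -> (b < m)%N]].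
Proof.
move=> hG uN; have [Gsub Gex] := hG.
have /choice[f fP] (kN : nat * set nat) : exists M, unbounded kN.2 ->
    [/\ unbounded M, M `<=` kN.2 & forall B, sorted ltn B ->
      (forall b, b \in B -> (b < kN.1)%N) -> Good B M].
  have [u|] := pselect (unbounded kN.2); last by exists set0.
  by have [M MP] := thin_bounded kN.1 hG u; exists M.
pose Ns := nat_rect (fun=> set nat) (f (0%N, N)) (fun k M => f (k.+1, M)).
have uNs k : unbounded (Ns k).
  by elim: k => [|k IH]; [case: (fP (0%N, N) uN)|case: (fP (k.+1, Ns k) IH)].
have NsS k : Ns k.+1 `<=` Ns k by case: (fP (k.+1, Ns k) (uNs k)).
have Ns_sub i j : (i <= j)%N -> Ns j `<=` Ns i.
  elim: j => [|j IH]; first by rewrite leqn0 => /eqP->.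
  rewrite leq_eqVlt => /orP[/eqP->//|]; rewrite ltnS => /IH.
  exact: subset_trans.
have NsG k B : sorted ltn B -> (forall b, b \in B -> (b < k)%N) -> Good B (Ns k).
  by case: k => [|k]; [case: (fP (0%N, N) uN) => _ _; apply
                      |case: (fP (k.+1, Ns k) (uNs k)) => _ _; apply].
have Ns0N : Ns 0%N `<=` N by case: (fP (0%N, N) uN).
have [|s [hs [n sn] sS]] :=
  @increasing_choice (fun k n m => Ns (if k is 0%N then 0%N else n.+1) m).
  by move=> k n; exact: uNs.
have sNs i j : (i < j)%N -> Ns (s i).+1 (s j).
  case: j => // j; rewrite ltnS => ij; apply: Ns_sub (sS j).
  by move: ij; rewrite leq_eqVlt => /orP[/eqP->|/hs/ltnW].
have s0 j : Ns 0%N (s j) by case: j => // j; exact: Ns_sub (sS j).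
exists (range s); split => [||B sB BM]; first exact: unbounded_range.
  by move=> _ [j _ <-]; exact: Ns0N.
case/lastP: B sB BM => [|B b] sB BM.
  by apply: (@Gsub _ (Ns 0%N)); [move=> _ [[j _ <-] _]|exact: NsG].
have [i _ si] : range s b by apply: BM; rewrite mem_rcons mem_head.
apply: (@Gsub _ (Ns b.+1)).
  move=> _ [[j _ <-] /(_ b)]; rewrite mem_rcons mem_head -si => /(_ isT) ij.
  apply: sNs; rewrite ltnNge; apply/negP; rewrite leq_eqVlt => /orP[/eqP ji|/hs].
    by move: ij; rewrite ji ltnn.
  by rewrite ltnNge (ltnW ij).
apply: NsG => // c; rewrite mem_rcons inE ltnS => /orP[/eqP->//|cB].
move: sB; rewrite (sorted_pairwise ltn_trans) pairwise_rcons => /andP[/allP h _].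
exact/ltnW/h.
Qed.

End diagonalization.

(** * Families of finite sets of bounded rank and Schreier families *)

Lemma fmin_mem (F : {fset nat}) : F != fset0 -> fmin F \in F.
Proof.
move=> F0; rewrite /fmin -[_ \in F](mem_sort leq).
case E : (sort leq F) => [|x s]; last exact: mem_head.
case/fset0Pn: F0 => x xF; have : x \in sort leq F by rewrite mem_sort.
by rewrite E.
Qed.

Lemma block_ltI (E F : {fset nat}) : F != fset0 ->
  (forall x y, x \in E -> y \in F -> (x < y)%N) -> E != fset0 -> block_lt E F.
Proof.
move=> /fmin_mem mF EF /fset0Pn[x xE].
rewrite /block_lt /fmax -(ltn_predK (EF _ _ xE mF)) ltnS.
apply/bigmax_leqP_seq => y yE _.
by rewrite -ltnS (ltn_predK (EF _ _ xE mF)) EF.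
Qed.

Definition to_fset (l : seq nat) : {fset nat} := [fset x in l]%fset.

Lemma in_to_fset l x : (x \in to_fset l) = (x \in l).
Proof. by rewrite inE. Qed.

Lemma to_fset_nil : to_fset [::] = fset0.
Proof. by apply/fsetP => x; rewrite !inE. Qed.

Lemma to_fset1 n : to_fset [:: n] = [fset n]%fset.
Proof. by apply/fsetP => x; rewrite in_to_fset !inE. Qed.

Lemma to_fset_neq0 (l : seq nat) : (to_fset l != fset0) = (l != [::]).
Proof.
case: l => [|x l]; first by rewrite to_fset_nil !eqxx.
by apply/fset0Pn; exists x; rewrite in_to_fset mem_head.
Qed.

(** Empty lists are discarded because the blocks of [family_comp] are nonempty. At most [size L]
    block minima remain, and each is an element of the union, hence at least [size L]. *)
Lemma schreier_one_comp (S : fin_family) (L : seq (seq nat)) :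
  sorted ltn (flatten L) -> (forall l, l \in L -> S (to_fset l)) ->
  (forall x, x \in flatten L -> (size L <= x)%N) ->
  family_comp schreier_one S (to_fset (flatten L)).
Proof.
move=> sL LS Lx; pose L' := [seq l <- L | l != [::]].
have L'E : flatten L' = flatten L.
  by rewrite /L'; elim: (L) => //= -[|x l] L1 IH //=; rewrite IH.
have L'0 l : l \in L' -> l != [::] /\ l \in L by rewrite mem_filter => /andP.
pose G := map to_fset L'.
left; exists G; split.
- rewrite -L'E (sorted_pairwise ltn_trans) in sL.
  apply: pairwise_sorted; rewrite /G pairwise_map.
  elim: (L') L'0 sL => //= l L1 IH hL1; rewrite pairwise_cat => /and3P[lL1 _ pL1].
  rewrite IH // ?andbT; last by move=> l1 h; apply: hL1; rewrite inE h orbT.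
  apply/allP => l1 l1L; have [l0 _] := hL1 _ (mem_head _ _).
  have [l10 _] := hL1 l1 (@mem_behead _ (l :: L1) _ l1L).
  apply: block_ltI; rewrite ?to_fset_neq0// => x y; rewrite !in_to_fset => xl yl1.
  by apply: (allrelP lL1) => //; apply/flattenP; exists l1.
- by move=> _ /mapP[l /L'0[l0 lL] ->]; rewrite to_fset_neq0; split => //; exact: LS.
- have [G0|G0] := eqVneq G [::].
    by right; apply/fsetP => x; rewrite /= G0; apply/imfsetP => -[].
  left; set H := [fset fmin g | g in G]%fset => /=.
  have H0 : H != fset0.
    case: (G) G0 @H => // g G1 _ H; apply/fset0Pn; exists (fmin g).
    by apply/imfsetP; exists g => //=; rewrite mem_head.
  have /imfsetP[/= g /mapP[l /L'0[l0 lL] ->] ->] := fmin_mem H0.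
  apply: (@leq_trans (size L)).
    apply: leq_trans (leq_imfset_card _ _ _) _.
    rewrite (leq_trans (size_undup _))// size_map size_filter count_size//.
  apply: Lx; apply/flattenP; exists l => //.
  by have := @fmin_mem (to_fset l); rewrite to_fset_neq0 in_to_fset; apply.
- apply/fsetP => x; rewrite in_to_fset -L'E.
  apply/flattenP/bigfcupP => [[l lL xl]|[g]].
    by exists (to_fset l); rewrite ?in_to_fset// andbT; exact: map_f.
  by rewrite andbT => /mapP[l lL ->]; rewrite in_to_fset => xl; exists l.
Qed.

Lemma schreier_singleton lad xi n : ladder_system lad ->
  (0 < n)%N -> schreier lad xi [fset n]%fset.
Proof.
move=> hlad n0; elim/ord_ind: xi => xi IH.
have [->|[b xib]|lxi] := ord_cases xi.
- by rewrite schreier0; left; exists n.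
- rewrite xib schreierS -to_fset1 -[[:: n]]/(flatten [:: [:: n]]).
  apply: schreier_one_comp => // [l|x]; last first.
    by rewrite inE => /eqP->.
  by rewrite inE => /eqP->; rewrite to_fset1; apply: IH; rewrite xib ltoS.
- rewrite schreierL//; left; exists 0%N; split.
    have [linc [lub _]] := hlad.2 _ lxi; apply: IH.
    by apply: lt_le_trans (linc 0%N 1%N isT) _; apply: lub; exists 1%N.
  by have := @fmin_mem [fset n]%fset; rewrite -cardfs_gt0 cardfs1 inE => /(_ isT)/eqP->.
Qed.

(** A tree of finite sequences with a strictly decreasing ordinal rank. The floor [c] allows it to
    be sliced at an intermediate level. *)
Definition rank_tree (c : omega1) (T : seq nat -> Prop) (rho : seq nat -> omega1) :=
  (forall A b, T (rcons A b) -> T A /\ rho (rcons A b) < rho A) /\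
  (forall A, T A -> c <= rho A).

Lemma rank_tree_nil c T rho A : rank_tree c T rho -> T A -> T [::].
Proof. by move=> [h _]; elim/last_ind: A => // A b IH /h[/IH]. Qed.

Section schreier_thinning.
Variables (lad : omega1 -> nat -> omega1) (hlad : ladder_system lad).
Variables (e : nat -> nat) (e_incr : {homo e : m n / (m < n)%N}).
Hypothesis e_gt : forall k, (k < e k)%N.

Definition image_family (S : fin_family) (A : seq nat) : Prop :=
  S (to_fset (map e A)).

Definition block_union (S : fin_family) (n : nat) (A : seq nat) : Prop :=
  exists L, [/\ (size L <= n)%N, A = flatten L & forall l, l \in L -> image_family S l].

(** Since [rho] decreases along the tree, the bound at the root confines all ranks to [c, d). *)
Definition thins (c d : omega1) (Q : seq nat -> Prop) : Prop :=
  forall T rho, rank_tree c T rho -> (T [::] -> rho [::] < d) ->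
  forall N, unbounded N -> exists M, [/\ unbounded M, M `<=` N &
    forall A, sorted ltn A -> (forall a, a \in A -> M a) -> T A -> Q A].

(** Ranks decrease along [A], so the level [c'] is crossed at most once; [b] is the element at which
    this happens. *)
Lemma rank_tree_split c c' T rho A : rank_tree c T rho -> T A ->
  [\/ c' <= rho A, rho [::] < c' | exists B b D,
    [/\ A = rcons B b ++ D, c' <= rho B & rho (rcons B b) < c']].
Proof.
move=> [h _]; elim/last_ind: A => [|A a IH].
  by case: (leP c' (rho [::])) => ? _; [exact: Or31|exact: Or32].
move=> TA; have [/IH[c'A|?|[B [b [D [-> ? ?]]]]] _] := h _ _ TA.
- have [?|?] := leP c' (rho (rcons A a)); first exact: Or31.
  by apply: Or33; exists A, a, [::]; rewrite cats0.
- exact: Or32.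
- by apply: Or33; exists B, b, (rcons D a); rewrite rcons_cat.
Qed.

(** Each addition of [x] costs two blocks: the part of a sequence with ranks at least [c'] is one
    set, the element that crosses this level is a singleton, and the rest falls under the induction
    hypothesis. *)
Lemma thins_blocks zeta (x : omega1) n c :
  (forall c, thins c (oadd c x) (image_family (schreier lad zeta))) ->
  thins c (iter n (oadd^~ x) c) (block_union (schreier lad zeta) n.*2).
Proof.
move=> hx; elim: n => [|n IH] T rho hT T0 N uN.
  exists N; split=> // A _ _ /(rank_tree_nil hT) T1.
  by have := hT.2 _ T1; rewrite leNgt T0.
set c' := iter n (oadd^~ x) c.
have [||M0 [uM0 M0N M0S]] :=
  hx c' (fun A => T A /\ c' <= rho A) rho _ _ N uN.
- split=> [A b [/hT.1[TA lt] c'A]|A []//].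
  by do ![split => //]; exact: ltW (le_lt_trans c'A lt).
- by case=> /T0.
(* The continuations of a stem [B] of rank below [c'] form a tree to which [IH] applies. One
   thinning has to serve all these stems, whence the diagonalization. *)
pose Good B M := T B -> rho B < c' -> forall D, sorted ltn D ->
  (forall d, d \in D -> M d) -> T (B ++ D) ->
  block_union (schreier lad zeta) n.*2 D.
have [|M [uM MM0 MG]] := @diagonal_thinning Good M0 _ uM0.
  split=> [B M M' M'M G TB rB D sD DM' TD|B M uM].
    by apply: G => // d /DM'; exact: M'M.
  have [[TB rB]|NB] := pselect (T B /\ rho B < c'); last first.
    by exists M; split => // TB rB; exfalso; apply: NB.
  have [||M' [uM' M'M M'P]] := IH (fun D => T (B ++ D)) (fun D => rho (B ++ D)) _ _ M uM.
  - by split=> [A b|A]; [rewrite -rcons_cat => /hT.1|move/hT.2].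
  - by rewrite cats0.
  by exists M'; split => // _ _ D sD DM'; exact: M'P.
exists M; split => // [|A sA AM TA]; first exact: subset_trans M0N.
have singl b : image_family (schreier lad zeta) [:: b].
  rewrite /image_family /= to_fset1; apply: schreier_singleton => //.
  exact: leq_ltn_trans (e_gt b).
have AM0 a : a \in A -> M0 a by move=> /AM; exact: MM0.
have [c'A|r0|[B [b [D [AE c'B rBb]]]]] := rank_tree_split c' hT TA.
- exists [:: A]; split; rewrite //= ?cats0// => l; rewrite inE => /eqP->.
  exact: M0S.
- have T1 := rank_tree_nil hT TA.
  have [//|//||L [sL LA LS]] := MG [::] _ _ T1 r0 A sA _ TA.
    by move=> d /AM; split.
  by exists L; split => //; rewrite (leq_trans sL)// leq_double.
- move: (sA); rewrite AE (sorted_pairwise ltn_trans) pairwise_cat.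
  move=> /and3P[/allrelP BD pB pD].
  have Tpre D' : T (rcons B b ++ D') -> T (rcons B b).
    elim/last_ind: D' => [|D' d IHD]; first by rewrite cats0.
    by rewrite -rcons_cat => /hT.1[/IHD].
  have TBb : T (rcons B b) by apply: (Tpre D); rewrite -AE.
  have BA y : y \in rcons B b -> y \in A by rewrite AE mem_cat => ->.
  have [|||||L [sL LA LS]] := MG (rcons B b) _ _ TBb rBb D _ _ _.
  - by rewrite (sorted_pairwise ltn_trans).
  - by move=> y /BA/AM.
  - by rewrite (sorted_pairwise ltn_trans).
  - move=> d dD; split; first by apply: AM; rewrite AE mem_cat dD orbT.
    by move=> y yB; exact: BD.
  - by rewrite -AE.
  exists (B :: [:: b] :: L); split => //=.
  + by rewrite cat_rcons LA.
  + move=> l; rewrite !inE => /or3P[/eqP->|/eqP->|/LS//]; last exact: singl.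
    apply: M0S => [|y yB|].
    * rewrite (sorted_pairwise ltn_trans); move: pB.
      by rewrite pairwise_rcons => /andP[].
    * by apply: AM0; apply: BA; rewrite mem_rcons inE yB orbT.
    * by split => //; have [] := hT.1 _ _ TBb.
Qed.

(** The rank of the root allows [xi] to be lowered. For a successor it lies below finitely many
    summands [oexp omega b] added to [c], which [thins_blocks] turns into blocks; for a limit it
    lies below [oexp omega (osucc (lad xi n))] added to [c] for some [n]. Discarding small indices
    absorbs the number [n]. *)
Lemma thins_schreier xi c :
  thins c (oadd c (oexp omega xi)) (image_family (schreier lad xi)).
Proof.
elim/ord_ind: xi c => xi IH c T rho hT T0 N uN.
have [T1|NT] := pselect (T [::]); last first.
  by exists N; split => // A _ _ /(rank_tree_nil hT).
have := T0 T1; have [xi0|[b xib]|lxi] := ord_cases xi.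
(* A root of rank at most [c] has no extension in the tree, as ranks drop strictly and stay at least
   [c]. *)
- rewrite xi0 oexp0 oaddS oadd0 ltSo => r0; exists N; split => // A _ _ TA.
  have [A0|A0] := eqVneq A [::].
    by rewrite /image_family schreier0; right; rewrite A0 /= to_fset_nil.
  exfalso; case/lastP: A A0 TA => // A a _ TA.
  suff : rho (rcons A a) < c by rewrite ltNge (hT.2 _ TA).
  apply: lt_le_trans r0; elim/last_ind: A a TA => [|A a' IHA] a TA.
    exact: (hT.1 _ _ TA).2.
  by have [TA' lt] := hT.1 _ _ TA; exact: lt_trans lt (IHA _ TA').
- rewrite xib oexpS => /oadd_omul_omega_ltP[n rn].
  have [|c0|M [uM MN MP]] := @thins_blocks b (oexp omega b) n c _ T rho hT _ N uN => //.
    by move=> c'; apply: IH; rewrite xib ltoS.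
  (* For [a >= n.*2] also [e a > n.*2], so the at most [n.*2] blocks satisfy the condition of
     [schreier_one]. *)
  exists [set m | M m /\ (n.*2 <= m)%N]; split.
  + exact: unbounded_geq.
  + by move=> m [/MN].
  + move=> A sA AM TA; have [|L [sL AL LS]] := MP A sA _ TA.
      by move=> a /AM[].
    rewrite /image_family schreierS AL map_flatten.
    apply: schreier_one_comp.
    * by rewrite -map_flatten -AL; exact: homo_sorted sA.
    * by move=> _ /mapP[l lL ->]; exact: LS.
    * move=> y; rewrite -map_flatten -AL size_map => /mapP[a /AM[_ na] ->].
      by rewrite (leq_trans sL)// (leq_trans na)// ltnW.
- move=> r0; have [linc [lub lmin]] := hlad.2 _ lxi.
  have [n rn] : exists n, rho [::] < oadd c (oexp omega (osucc (lad xi n))).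
    have [d rd] := oadd_subK (hT.2 _ T1); move: r0; rewrite rd oadd_ltE.
    move=> /(oiter_limit_ltP lxi)[b bxi db].
    have [n bn] : exists n, b < osucc (lad xi n).
      apply: contrapT => h; have := lmin b; rewrite leNgt bxi => H.
      suff // : false by []; apply: H => _ [n _ <-].
      by rewrite leNgt; apply/negP => ?; apply: h; exists n.
    exists n; rewrite oadd_ltE; apply: lt_le_trans db _.
    exact/oexp_omega_le/ltW.
  have lxin : osucc (lad xi n) < xi.
    by apply: lt_le_trans (linc n n.+1 (ltnSn n)) _; apply: lub; exists n.+1.
  have [//|M [uM MN MP]] := IH _ lxin c T rho hT _ N uN.
  (* From [n <= a < e a] comes the condition [n.+1 <= fmin F] of the limit clause. *)
  exists [set m | M m /\ (n <= m)%N]; split.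
  + exact: unbounded_geq.
  + by move=> m [/MN].
  + move=> A sA AM TA; rewrite /image_family schreierL//.
    have [A0|A0] := eqVneq A [::].
      by right; rewrite A0 /= to_fset_nil.
    left; exists n; split; first by apply: MP => // a /AM[].
    have := @fmin_mem (to_fset (map e A)).
    rewrite to_fset_neq0 -size_eq0 size_map size_eq0 => /(_ A0).
    by rewrite in_to_fset => /mapP[a /AM[_ na] ->]; exact: leq_ltn_trans na (e_gt a).
Qed.

End schreier_thinning.

(** * Point-finite families of closed sets of ordinals *)

(* For a set of positive ordinals, being closed in the order topology; only
   left neighbourhoods matter because (u, b] is a neighbourhood of b. *)
Definition left_closed (U : set omega1) : Prop :=
  ~ U ozero /\ forall b, ~ U b -> ozero < b ->
    exists2 u, u < b & forall s, u < s -> s <= b -> ~ U s.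

(** Induction on an upper end [b] takes the place of compactness. If [b] is outside [U], closedness
    moves the end down. If [b] is in [U], the points just to its left have smaller rank, so only
    [cb_rank b] and the maximum up to some [u < b] compete; in case of a tie [b] joins the list. *)
Lemma cb_rank_max (U : set omega1) a : left_closed U ->
  (forall t, U t -> t <= a) -> U !=set0 ->
  exists g (P : seq omega1), [/\ exists2 t, U t & cb_rank t = g,
    (forall t, U t -> cb_rank t <= g) &
    forall t, U t -> cb_rank t = g -> t \in P].
Proof.
move=> [U0 cU] Ua [t0 Ut0].
suff h b : (exists2 t, U t & t <= b) ->
    exists g (P : seq omega1), [/\ exists2 t, U t & cb_rank t = g,
      (forall t, U t -> t <= b -> cb_rank t <= g) &
      forall t, U t -> t <= b -> cb_rank t = g -> t \in P].
  have [|g [P [gP1 gP2 gP3]]] := h a; first by exists t0 => //; exact: Ua.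
  exists g, P; split => // t Ut; first exact/gP2/Ua.
  by move=> tg; apply: gP3 => //; exact: Ua.
elim/ord_ind: b => b IH [t Ut tb].
have b0 : ozero < b.
  apply: lt_le_trans tb; rewrite ord_gt0; apply/eqP => t0'; apply: U0.
  by rewrite -t0'.
have [Ub|NUb] := pselect (U b); last first.
  have [u ub uP] := cU b NUb b0.
  have le_u s : U s -> s <= b -> s <= u.
    by move=> Us sb; rewrite leNgt; apply/negP => us; exact: (uP s).
  have [|g [P [gP1 gP2 gP3]]] := IH u ub; first by exists t => //; exact: le_u.
  exists g, P; split => // s Us sb; first by apply: gP2 => //; exact: le_u.
  by apply: gP3 => //; exact: le_u.
have [[u ub uP] _] := cb_rankP b0.
have near_b s : s <= b -> [\/ s = b, s <= u | cb_rank s < cb_rank b].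
  rewrite le_eqVlt => /orP[/eqP->|sb]; first exact: Or31.
  by have [?|us] := leP s u; [exact: Or32|apply: Or33; exact: uP].
have [hu|Nu] := pselect (exists2 t, U t & t <= u); last first.
  exists (cb_rank b), [:: b];
  split => [|s Us /near_b[->//|su|/ltW//]|s Us /near_b[->|su|]].
  - by exists b.
  - by exfalso; apply: Nu; exists s.
  - by rewrite mem_head.
  - by exfalso; apply: Nu; exists s.
  - by move=> + sb; rewrite sb ltxx.
have [g [P [gP1 gP2 gP3]]] := IH u ub hu.
have [bg|gb|bg] := ltgtP (cb_rank b) g.
- exists g, P; split => // s Us /near_b[->|su|sb]; rewrite ?(ltW bg)//.
  + exact: gP2.
  + exact: ltW (lt_trans sb bg).
  + by move=> h; move: bg; rewrite h ltxx.
  + exact: gP3.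
  + by move=> h; move: (lt_trans sb bg); rewrite h ltxx.
- exists (cb_rank b), [:: b]; split; first by exists b.
  + move=> s Us /near_b[->//|su|/ltW//]; apply: ltW (le_lt_trans _ gb).
    exact: gP2.
  + move=> s Us /near_b[->|su h|sb h]; first by rewrite mem_head.
      by have := gP2 s Us su; rewrite h leNgt gb.
    by move: sb; rewrite h ltxx.
- exists g, (b :: P); split => // s Us /near_b[->|su|].
  + by rewrite bg.
  + exact: gP2.
  + by rewrite bg => /ltW.
  + by rewrite mem_head.
  + by move=> h; rewrite inE gP3 ?orbT.
  + by rewrite bg => + h; rewrite h ltxx.
Qed.

Section intersections.
Variables (lad : omega1 -> nat -> omega1) (hlad : ladder_system lad).
Variables (e : nat -> nat) (e_incr : {homo e : m n / (m < n)%N}).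
Hypothesis e_gt : forall k, (k < e k)%N.
Variables (xi : omega1) (U : nat -> set omega1).
Let top := oexp omega (oexp omega xi).
Hypothesis U_closed : forall n, left_closed (U n).
Hypothesis U_le : forall n t, U n t -> t <= top.
Hypothesis U_finite : forall t, exists j, forall n, (j <= n)%N -> ~ U n t.

(** The first two clauses keep [UI [::]] a bounded set of positive ordinals. *)
Let UI (A : seq nat) : set omega1 :=
  [set t | [/\ ozero < t, t <= top & forall n, n \in A -> U n t]].

Let UI_closed A : left_closed (UI A).
Proof.
split=> [[]|b Nb b0]; first by rewrite ltxx.
have [bt|tb] := leP b top; last first.
  by exists top => // s ts sb [_]; rewrite leNgt ts.
have [n nA Ub] : exists2 n, n \in A & ~ U n b.
  apply: contrapT => h; apply: Nb; split => // n nA.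
  by apply: contrapT => ?; apply: h; exists n.
have [u ub uP] := (U_closed n).2 b Ub b0.
by exists u => // s us sb [_ _ /(_ n nA)]; exact: uP.
Qed.

Let U_finite_seq (P : seq omega1) :
  exists j, forall n, (j <= n)%N -> forall t, t \in P -> ~ U n t.
Proof.
elim: P => [|p P [j jP]]; first by exists 0%N.
have [i iP] := U_finite p; exists (maxn i j) => n; rewrite geq_max => /andP[ni nj] t.
by rewrite inE => /orP[/eqP->|]; [exact: iP|exact: jP].
Qed.

(** The first element [m] is spent on excluding [top]: the points left are below [top] and so have
    rank less than [oexp omega xi], and the tree of continuations of [[:: m]] falls under
    [thins_schreier] with floor [ozero]. *)
Lemma schreier_intersections : exists2 M, unbounded M &
  forall m D, sorted ltn (m :: D) -> (forall a, a \in m :: D -> M a) ->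
    (exists t, forall a, a \in m :: D -> U a t) ->
    image_family e (schreier lad xi) D.
Proof.
(* [gP A] pairs the maximal rank on [UI A] with a finite list containing all points that attain
   it. *)
have /choice[gP gPP] (A : seq nat) : exists gP : omega1 * seq omega1, UI A !=set0 ->
    [/\ exists2 t, UI A t & cb_rank t = gP.1,
    (forall t, UI A t -> cb_rank t <= gP.1) &
    forall t, UI A t -> cb_rank t = gP.1 -> t \in gP.2].
  have [h|N] := pselect (UI A !=set0); last by exists (ozero, [::]).
  have [|g [P h']] := @cb_rank_max _ top (UI_closed A) _ h; last by exists (g, P).
  by move=> t [].
have [j0 j0P] := U_finite top.
pose N0 : set nat := [set n | setT n /\ (j0 <= n)%N].
have uN0 : unbounded N0 by apply: unbounded_geq => n; exists n.+1.
(* Elements that follow a stem [B] index sets that avoid the points of maximal rank of [UI B]. *)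
pose Good1 B (M : set nat) := forall m, M m -> forall t, t \in (gP B).2 -> ~ U m t.
have [|M1 [uM1 M1N M1G]] := @diagonal_thinning Good1 N0 _ uN0.
  split=> [B M M' M'M G m /M'M|B N uN]; first exact: G.
  have [j jP] := U_finite_seq (gP B).2.
  exists [set m | N m /\ (j <= m)%N]; split; first exact: unbounded_geq.
    by move=> m [].
  by move=> m [_ jm] t tP; exact: jP.
pose T A := [/\ sorted ltn A, forall a, a \in A -> M1 a & UI A !=set0].
pose rho A := (gP A).1.
have hT A b : T (rcons A b) -> T A /\ rho (rcons A b) < rho A.
  move=> [sA AM Ut]; have [t0 [t00 t0t t0P]] := Ut.
  have inA a : a \in A -> a \in rcons A b by rewrite mem_rcons inE => ->; rewrite orbT.
  move: sA; rewrite (sorted_pairwise ltn_trans) pairwise_rcons => /andP[/allP Ab pA].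
  have TA : T A.
    split; first by rewrite (sorted_pairwise ltn_trans).
    - by move=> a /inA/AM.
    - by exists t0; split => // n /inA; exact: t0P.
  split => //; have [sA' AM' UA] := TA.
  have [[q [q0 qt qP] rq] _ _] := gPP _ Ut.
  have UAq : UI A q by split => // n /inA; exact: qP.
  have [_ h1 h2] := gPP _ UA.
  (* If the maximal rank did not drop, its witness [q] would be on the list of maximal points of
     [UI A], which [U b] avoids. *)
  rewrite lt_neqAle /rho -rq h1 // andbT; apply/eqP => /(h2 _ UAq) qPA.
  have bA : b \in rcons A b by rewrite mem_rcons mem_head.
  apply: (M1G A sA' AM' b _ q qPA); last exact: qP.
  by split => [|a /Ab//]; exact: AM.
(* Stems are nonempty here: their first element is at least [j0] and keeps [top] out of the
   intersection. *)
pose Good2 B (M : set nat) := T B -> B <> [::] -> forall D, sorted ltn D ->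
  (forall a, a \in D -> M a) -> T (B ++ D) -> image_family e (schreier lad xi) D.
have [|M [uM MM1 MG]] := @diagonal_thinning Good2 M1 _ uM1.
  split=> [B M M' M'M G TB B0 D sD DM TD|B N uN].
    by apply: G => // a /DM; exact: M'M.
  have [[TB B0]|NB] := pselect (T B /\ B <> [::]); last first.
    by exists N; split => // TB B0; exfalso; apply: NB.
  have [||M [uM MN MP]] := @thins_schreier lad hlad e e_incr e_gt xi ozero
      (fun D => T (B ++ D)) (fun D => rho (B ++ D)) _ _ N uN.
  - by split=> [A b|A _]; [rewrite -rcons_cat => /hT|exact: ozero_le].
  - rewrite cats0 => _; apply: lt_le_trans (le_oaddl _ _).
    have [_ BM UB] := TB; have [[q [q0 qt qP] rq] _ _] := gPP _ UB.
    rewrite /rho -rq; apply: cb_rank_oexp_omega => //.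
    rewrite lt_neqAle qt andbT; apply/eqP => qtop.
    case: B B0 BM qP {TB UB rq} => // m B _ BM qP.
    apply: (j0P m); first by have [] := M1N _ (BM _ (mem_head _ _)).
    by have := qP m (mem_head _ _); rewrite qtop.
  by exists M; split => // _ _ D sD DM TD; exact: MP.
exists M => // m D smD mDM [t tP].
have UIs A : {subset A <= m :: D} -> UI A !=set0.
  move=> AmD; exists t; split; last by move=> n /AmD/tP.
    rewrite ord_gt0; apply/eqP => t0; apply: (U_closed m).1.
    by rewrite -t0; exact/tP/mem_head.
  exact/(@U_le m)/tP/mem_head.
have Tm : T [:: m].
  split => //; last by apply: UIs => a; rewrite !inE => ->.
  by move=> a; rewrite inE => /eqP->; exact/MM1/mDM/mem_head.
have TmD : T (m :: D).
  by split => //; [move=> a /mDM/MM1|exact: UIs].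
have inD a : a \in D -> a \in m :: D by rewrite inE orbC => ->.
apply: (MG [:: m]) => //.
- by move=> a; rewrite inE => /eqP->; exact/mDM/mem_head.
- exact: path_sorted smD.
- move=> a aD; split; first exact/mDM/inD.
  move=> b; rewrite inE => /eqP->.
  move: smD; rewrite (sorted_pairwise ltn_trans) => /= /andP[/allP h _].
  exact: h.
Qed.

End intersections.

Local Open Scope ring_scope.

(** * Subsequences of basic sequences *)

Section subsequences.
Variables (K : numFieldType) (V : normedModType K).
Implicit Types (y : nat -> V) (s : nat -> nat) (a b : nat -> K) (C : K).

Lemma sum_increasing (g : nat -> V) s k : {homo s : m n / (m < n)%N} ->
  (forall n, ~ range s n -> g n = 0) ->
  \sum_(n < s k) g n = \sum_(j < k) g (s j).
Proof.
move=> hs g0; have nr i n : (s i < n < s i.+1)%N -> ~ range s n.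
  move=> /andP[+ +] [j _ jn]; rewrite -{n}jn !(leqW_mono (leq_mono hs)).
  by rewrite ltnS => ij; rewrite leqNgt ij.
elim: k => [|k IH].
  rewrite big_ord0 big1 // => -[n /= n0] _; apply: g0 => -[j _ jn].
  by move: n0; rewrite -jn (leqW_mono (leq_mono hs)).
rewrite big_ord_recr /= -IH -!(big_mkord xpredT g) (big_cat_nat _ (n := (s k).+1)) //=;
  last exact: hs.
have -> : \sum_((s k).+1 <= n < s k.+1) g n = 0.
  by rewrite big_nat_cond big1 // => n /andP[h _]; exact/g0/nr/h.
by rewrite addr0 big_nat_recr.
Qed.

(** Uniform boundedness of the coordinate functionals on the span of [y]. *)
Definition coef_bound y C : Prop :=
  forall N a, (forall n, (N <= n)%N -> a n = 0) ->
  forall n, `|a n| <= C * `|\sum_(n < N) a n *: y n|.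

Lemma subseq_extend y s a N : {homo s : m n / (m < n)%N} ->
  (forall n, (N <= n)%N -> a n = 0) ->
  exists a' N', [/\ forall k, a' (s k) = a k, forall n, ~ range s n -> a' n = 0,
    forall n, (N' <= n)%N -> a' n = 0 &
    \sum_(n < N') a' n *: y n = \sum_(k < N) a k *: y (s k)].
Proof.
move=> hs aN; have s_inj : injective s by apply: inc_inj; exact: leq_mono.
pose a' n := \sum_(k < N) if s k == n then a k else 0.
have a's k : a' (s k) = a k.
  have [kN|Nk] := ltnP k N.
    rewrite /a' (bigD1 (Ordinal kN)) //= eqxx big1 ?addr0 // => i ik.
    rewrite ifF //; apply/negbTE; apply: contraNneq ik => /s_inj ik.
    exact/eqP/val_inj.
  rewrite aN // /a' big1 // => i _; rewrite ifF //; apply/negbTE/eqP => /s_inj ik.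
  by move: Nk; rewrite -ik leqNgt ltn_ord.
have a'0 n : ~ range s n -> a' n = 0.
  move=> Nr; rewrite /a' big1 // => i _; rewrite ifF //.
  by apply/negbTE/eqP => h; apply: Nr; exists i.
exists a', (s N); split => //.
- move=> n Nn; have [[k _ kn]|/a'0 //] := pselect (range s n).
  by rewrite -kn a's aN //; move: Nn; rewrite -kn (leq_mono hs).
- rewrite (sum_increasing _ (g := fun n => a' n *: y n)) //; last first.
    by move=> n /a'0 ->; rewrite scale0r.
  by apply: eq_bigr => k _; rewrite a's.
Qed.

Lemma coef_bound_subseq y s C : {homo s : m n / (m < n)%N} ->
  coef_bound y C -> coef_bound (y \o s) C.
Proof.
move=> hs hy N a aN n; have [a' [N' [a's _ a'N <-]]] := subseq_extend y hs aN.
by rewrite -a's; exact: hy.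
Qed.

(** The coefficient bound is applied to [a - b] truncated at a large [N]; [eps] pays for the
    distance from [v] to the partial sum. *)
Lemma coef_bound_cvg y C a v b M : 0 < C -> coef_bound y C ->
  series (fun n => a n *: y n) @ \oo --> v ->
  (forall n, (M <= n)%N -> b n = 0) ->
  forall n eps, 0 < eps ->
  `|a n - b n| <= C * (`|v - \sum_(k < M) b k *: y k| + eps).
Proof.
move=> C0 hy /cvgrPdist_lt av bM n eps eps0.
have [N0 _ N0P] := av _ eps0.
pose N := maxn N0 (maxn M n.+1).
have vN : `|v - series (fun n => a n *: y n) N| < eps.
  by apply: N0P; rewrite /= leq_maxl.
pose c k := if (k < N)%N then a k - b k else 0.
have cN k : (N <= k)%N -> c k = 0 by rewrite leqNgt /c => /negbTE ->.
have nN : (n < N)%N by rewrite /N !leq_max leqnn !orbT.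
have MN : (M <= N)%N by rewrite /N !leq_max leqnn !orbT.
have := hy N c cN n; rewrite {1}/c nN => /le_trans; apply.
rewrite ler_pM2l//.
have -> : \sum_(k < N) c k *: y k =
    series (fun n => a n *: y n) N - \sum_(k < M) b k *: y k.
  rewrite /series /= big_mkord.
  have -> : \sum_(k < M) b k *: y k = \sum_(k < N) b k *: y k.
    rewrite (big_ord_widen N (fun k => b k *: y k) MN) big_mkcond /=.
    apply: eq_bigr => k _; case: ltnP => // /bM ->; by rewrite scale0r.
  rewrite -sumrB; apply: eq_bigr => k _; by rewrite /c ltn_ord scalerBl.
set S := series _ N; set w := \sum_(k < M) _.
have -> : S - w = (v - w) + (S - v) by rewrite [RHS]addrC addrA subrK.
by rewrite (le_trans (ler_normD _ _))// lerD // distrC ltW.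
Qed.

Lemma normr_small_eq0 (t C : K) : 0 < C ->
  (forall eps, 0 < eps -> `|t| <= C * eps) -> t = 0.
Proof.
move=> C0 h; apply/eqP/negPn/negP => t0.
have e0 : 0 < C^-1 * (`|t| / 2) by rewrite mulr_gt0 ?invr_gt0 // divr_gt0 // normr_gt0.
have := h _ e0; rewrite mulrA divff ?gt_eqF // mul1r => {}h.
suff : `|t| < `|t| by rewrite ltxx.
by rewrite (le_lt_trans h)// ltr_pdivrMr// mulr_natr mulr2n ltrDl normr_gt0.
Qed.

(** The expansion of [v] in [y] has zero coefficients off the range of [s], since [v] is a limit of
    finite combinations with this property and coefficients depend continuously on the vector. Its
    partial sums at the indices [s k] then give the expansion in [y \o s]. For uniqueness, the
    difference of two expansions converges to 0, which forces its coefficients to vanish. *)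
Lemma basic_subseq y s C : {homo s : m n / (m < n)%N} -> 0 < C ->
  coef_bound y C -> basic_seq y -> basic_seq (y \o s).
Proof.
move=> hs C0 hy bas v vz.
have trunc N b : exists b' : nat -> K, (forall n, (N <= n)%N -> b' n = 0) /\
    forall w : nat -> V, \sum_(i < N) b i *: w i = \sum_(i < N) b' i *: w i.
  exists (fun n => if (n < N)%N then b n else 0); split=> [n|w].
    by rewrite leqNgt => /negbTE ->.
  by apply: eq_bigr => i _; rewrite ltn_ord.
have vy : closure (lin_span y) v.
  apply: closure_subset vz => w [N [b ->]].
  have [b' [b'N ->]] := trunc N b.
  have [c [M [_ _ _ cE]]] := subseq_extend y hs b'N.
  by exists M, c; rewrite cE.
have [a [av _]] := bas v vy.
have a0 n : ~ range s n -> a n = 0.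
  move=> nr; apply: (@normr_small_eq0 _ (C * 2)) => [|eps eps0].
    by rewrite mulr_gt0.
  have [w [[N [b ->]] vw]] := vz _ (nbhsx_ballx v eps eps0).
  move: vw; have [b' [b'N ->]] := trunc N b.
  have [c [M [cs c0 cM <-]]] := subseq_extend y hs b'N.
  rewrite -ball_normE /= => vw.
  have := coef_bound_cvg C0 hy av cM n eps0; rewrite c0 // subr0 => /le_trans; apply.
  by rewrite -mulrA ler_pM2l // mulr_natl mulr2n lerD2r ltW.
have serE k : series (fun n => a (s n) *: y (s n)) k =
    series (fun n => a n *: y n) (s k).
  rewrite /series /= !big_mkord (sum_increasing _ (g := fun n => a n *: y n)) //.
  by move=> n /a0 ->; rewrite scale0r.
have az : series (fun n => a (s n) *: (y \o s) n) @ \oo --> v.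
  apply/cvgrPdist_lt => eps eps0; have /cvgrPdist_lt/(_ _ eps0)[N _ NP] := av.
  exists N => // k /= Nk; rewrite serE; apply: NP => /=.
  exact: leq_trans Nk (leq_increasing _ hs).
exists (fun n => a (s n)); split => // b bv; apply/funext => n.
apply/eqP; rewrite -subr_eq0; apply/eqP.
apply: (normr_small_eq0 C0) => eps eps0.
have hz := coef_bound_subseq hs hy.
have dv : series (fun n => (a (s n) - b n) *: (y \o s) n) @ \oo --> (0 : V).
  rewrite -(subrr v); apply: cvg_trans (cvgB az bv).
  apply: near_eq_cvg; near=> k; rewrite /= fctE /series /= -sumrB.
  by apply: eq_bigr => i _; rewrite scalerBl.
have := @coef_bound_cvg _ _ _ _ (fun=> 0) 0%N C0 hz dv (fun _ _ => erefl) n _ eps0.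
by rewrite big_ord0 !subr0 normr0 add0r.
Unshelve. all: by end_near. Qed.

(** The bound for [y] is applied to the coefficients extended by zero off the range of [s];
    membership in [S] is thus tested on the original indices, shifted by one. *)
Lemma family_bound_subseq (S : fin_family) y s C (D : seq nat) N a :
  (forall (F : {fset nat}) (N : nat) (a : nat -> K),
     S [fset n.+1 | n in F]%fset -> (forall n, (N <= n)%N -> a n = 0) ->
     `|\sum_(n <- F) a n *: y n| <= C * `|\sum_(n < N) a n *: y n|) ->
  {homo s : m n / (m < n)%N} -> uniq D ->
  S (to_fset [seq (s k).+1 | k <- D]) ->
  (forall n, (N <= n)%N -> a n = 0) ->
  `|\sum_(k <- D) a k *: y (s k)| <= C * `|\sum_(k < N) a k *: y (s k)|.
Proof.
move=> hS hs uD SD aN.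
have [a' [N' [a's _ a'N <-]]] := subseq_extend y hs aN.
have -> : \sum_(k <- D) a k *: y (s k) =
    \sum_(n <- to_fset (map s D)) a' n *: y n.
  rewrite [RHS](perm_big (map s D)) /=.
    by rewrite big_map; apply: eq_bigr => k _; rewrite a's.
  apply: uniq_perm => [||n]; [exact: fset_uniq| |exact: in_to_fset].
  by rewrite map_inj_uniq//; apply: inc_inj; exact: leq_mono.
apply: hS => //; suff -> : [fset n.+1 | n in to_fset (map s D)]%fset =
    to_fset [seq (s k).+1 | k <- D] by [].
apply/fsetP => m; rewrite in_to_fset; apply/imfsetP/mapP => /=.
  by move=> [n]; rewrite in_to_fset => /mapP[k kD ->] ->; exists k.
by move=> [k kD ->]; exists (s k) => //; rewrite in_to_fset map_f.
Qed.

End subsequences.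

(** * Evaluation functionals and superlevel sets in C(a) *)

Lemma contractive_continuous (K : numFieldType) (V : normedModType K)
  (phi : {linear V -> K^o}) : (forall v, `|phi v| <= `|v|) -> continuous phi.
Proof.
move=> h v; apply/cvgrPdist_lt => eps eps0; apply/nbhs_ballP; exists eps => //= w.
by rewrite -ball_normE /= => vw; rewrite -linearB (le_lt_trans (h _)).
Qed.

Section evaluation.
Variables (K : numFieldType) (a : omega1).
Implicit Types (f : Cspace K a) (t : order_topology (ordint a)).

Definition Cspace_eval t f : K^o :=
  (f : continuousType (order_topology (ordint a)) K^o) t.

Lemma Cspace_eval_linear t : linear (Cspace_eval t).
Proof. by []. Qed.

HB.instance Definition _ t :=
  GRing.isLinear.Build K (Cspace K a) K^o _ (Cspace_eval t) (Cspace_eval_linear t).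

Lemma Cspace_eval_sum t (r : seq nat) (c : nat -> K) (f : nat -> Cspace K a) :
  Cspace_eval t (\sum_(i <- r) c i *: f i) = \sum_(i <- r) c i * Cspace_eval t (f i).
Proof. by rewrite linear_sum. Qed.

Arguments Cspace_eval : simpl never.

Lemma Cspace_normE f : ([set: order_topology (ordint a)] !=set0) ->
  exists2 t, `|f| = `|Cspace_eval t f| & forall u, `|Cspace_eval u f| <= `|f|.
Proof.
move=> X0; have [t ft fP] := sup_normP f (@ordint_compact a) X0.
have fE : `|f| = `|Cspace_eval t f| by exact: ft.
by exists t => // u; rewrite fE; exact: fP.
Qed.

Lemma Cspace_eval_le t f : `|Cspace_eval t f| <= `|f|.
Proof. by have [|u _] := @Cspace_normE f; [exists t|apply]. Qed.

Lemma Cspace_norm_le f (c : K) : 0 <= c ->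
  (forall t, `|Cspace_eval t f| <= c) -> `|f| <= c.
Proof.
move=> c0 fc.
have [X0|N] := pselect ([set: order_topology (ordint a)] !=set0).
  by have [t -> _] := Cspace_normE f X0; exact: fc.
by have -> : `|f| = 0 by exact: (@sup_norm_empty _ _ f N).
Qed.

Lemma weakly_null_eval (x : nat -> Cspace K a) t eps : weakly_null x -> 0 < eps ->
  exists N, forall n, (N <= n)%N -> `|Cspace_eval t (x n)| < eps.
Proof.
move=> xw eps0; have /cvgrPdist_lt/(_ _ eps0)[N _ NP] :=
  xw (Cspace_eval t) (contractive_continuous (Cspace_eval_le t)).
by exists N => n /NP; rewrite sub0r normrN.
Qed.

Definition superlevel f (c : K) : set omega1 :=
  [set b | exists t : order_topology (ordint a), val (t : ordint a) = b /\
    c <= `|Cspace_eval t f|].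

(** A real [c] is comparable with every norm, so the complement is given by a strict inequality, an
    open condition by continuity. *)
Lemma superlevel_closed f c : c \is Num.real -> left_closed (superlevel f c).
Proof.
move=> cR; split=> [[t [t0 _]]|b Nb b0].
  have := valP (t : ordint a); rewrite t0 => /andP[+ _].
  by rewrite leSo ltxx.
have [ba|ab] := leP b a; last first.
  exists a => // s as_ sb [t [ts _]]; have := valP (t : ordint a).
  by rewrite ts => /andP[_]; rewrite leNgt as_.
have bP : (oone <= b <= a)%O by rewrite ba andbT leSo.
pose t : order_topology (ordint a) := Sub b bP : ordint a.
have ct : `|Cspace_eval t f| < c.
  rewrite real_ltNge ?normr_real //; apply/negP => h; apply: Nb.
  by exists t; split => //; rewrite SubK.
have : nbhs t [set u | `|Cspace_eval u f| < c].
  have /cvgrPdist_lt/(_ (c - `|Cspace_eval t f|)) :=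
    @cts_fun _ _ (f : continuousType (order_topology (ordint a)) K^o) t.
  rewrite subr_gt0 => /(_ ct); apply: filterS => u /= ftu.
  have -> : Cspace_eval u f = Cspace_eval t f - (Cspace_eval t f - Cspace_eval u f).
    by rewrite opprB addrC subrK.
  by rewrite (le_lt_trans (ler_normB _ _))// addrC -ltrBrDr.
rewrite itv_nbhsE => -[i [io ti] iU].
(* An open interval around [t] contains a left neighbourhood of [b]: [u] is its left endpoint, or
   [ozero] when it is unbounded on the left. *)
have [u ub uP] : exists2 u, (u < b)%O &
    forall v : order_topology (ordint a), (u < val (v : ordint a))%O ->
    (val (v : ordint a) <= b)%O -> v \in i.
  have ltE (v w : order_topology (ordint a)) :
    (v < w)%O = (val (v : ordint a) < val (w : ordint a))%O by exact: ltEsub.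
  case: i io ti {iU} => [[[] l|[]] [[] r|[]]] //= _; rewrite in_itv /= ?andbT.
  - move=> /andP[lb br]; exists (val (l : ordint a)).
      by move: lb; rewrite ltE SubK.
    by move=> v lv vb; rewrite in_itv /= ltE lv /= ltE (le_lt_trans vb).
  - move=> lb; exists (val (l : ordint a)); first by move: lb; rewrite ltE SubK.
    by move=> v lv vb; rewrite in_itv /= ltE lv.
  - by move=> br; exists ozero => // v v0 vb; rewrite in_itv /= ltE (le_lt_trans vb).
  - by move=> _; exists ozero.
exists u => // s us sb [v [vs cv]].
have /iU /= : v \in i by apply: uP; rewrite vs.
by move=> /(le_lt_trans cv); rewrite ltxx.
Qed.

End evaluation.

(** * From Schreier unconditionality to unconditionality *)

(** The interval [1, a] is countable. Once its points are coded by natural numbers, [s k] is chosen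
    so late that the bound holds at every point of code less than [k]. *)
Lemma pointwise_null_subseq (K : numFieldType) (a : omega1) (y : nat -> Cspace K a) :
  (forall t eps, 0 < eps ->
    exists N, forall n, (N <= n)%N -> `|Cspace_eval t (y n)| < eps) ->
  exists s : nat -> nat, {homo s : m n / (m < n)%N} /\
    forall t, exists j, forall k, (j <= k)%N ->
      `|Cspace_eval t (y (s k))| < 2^-1 ^+ k.
Proof.
move=> y0; have /countable_injP[f finj] := ord_segment_countable a.
pose g (t : order_topology (ordint a)) := f (val (t : ordint a)).
have ginj t u : g t = g u -> t = u.
  move=> gtu; apply/val_inj/finj => //; rewrite inE /=.
    by have /andP[] := valP (t : ordint a).
  by have /andP[] := valP (u : ordint a).
have small j eps : 0 < eps -> exists N, forall n, (N <= n)%N ->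
    forall t, (g t < j)%N -> `|Cspace_eval t (y n)| < eps.
  move=> eps0; elim: j => [|j [N NP]]; first by exists 0%N.
  have [[t tj]|Nj] := pselect (exists t, g t = j); last first.
    exists N => n Nn u; rewrite ltnS leq_eqVlt => /orP[/eqP uj|]; last exact: NP.
    by exfalso; apply: Nj; exists u.
  have [M MP] := y0 t _ eps0; exists (maxn M N) => n; rewrite geq_max => /andP[Mn Nn] u.
  rewrite ltnS leq_eqVlt => /orP[/eqP uj|]; last exact: NP.
  by rewrite (ginj u t) ?uj //; exact: MP.
have [|s [hs _ sP]] := @increasing_choice (fun k _ m => forall t, (g t < k)%N ->
    `|Cspace_eval t (y m)| < 2^-1 ^+ k).
  move=> k n; have [|N NP] := small k (2^-1 ^+ k).
    by rewrite exprn_gt0 // invr_gt0.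
  by exists (maxn N n.+1); [rewrite leq_maxr|apply: NP; rewrite leq_maxl].
exists s; split => // t; exists (g t).+1 => -[//|k] gk.
exact: sP.
Qed.

Lemma sum_geometric_le2 (K : numFieldType) (l : seq nat) : uniq l ->
  \sum_(n <- l) 2^-1 ^+ n <= 2 :> K.
Proof.
move=> ul.
have half0 n : 0 <= 2^-1 ^+ n :> K by rewrite exprn_ge0 // invr_ge0.
have [N lN] : exists N, forall n, n \in l -> (n < N)%N.
  by exists (\max_(n <- l) n).+1 => n nl; rewrite ltnS; exact: leq_bigmax_seq.
apply: (@le_trans _ _ (\sum_(n < N) 2^-1 ^+ n)).
  rewrite -(big_mkord xpredT (fun n => 2^-1 ^+ n)) /index_iota subn0.
  rewrite [leRHS](bigID (mem l)) /= -[X in _ <= X + _]big_filter.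
  rewrite [X in _ <= X + _](perm_big l) /=; first by rewrite lerDl sumr_ge0.
  apply: uniq_perm; rewrite ?filter_uniq ?iota_uniq // => n.
  rewrite mem_filter mem_iota /= add0n; apply/andP/idP => [[]//|nl].
  by split => //; exact: lN.
suff -> : \sum_(n < N) 2^-1 ^+ n = 2 - 2 * 2^-1 ^+ N :> K.
  by rewrite lerBlDr lerDl mulr_ge0.
elim: N {lN} => [|n IH]; first by rewrite big_ord0 expr0 mulr1 subrr.
rewrite big_ord_recr /= IH exprS mulrA divff ?pnatr_eq0 // mul1r.
by rewrite mulr_natl mulr2n opprD addrA subrK.
Qed.

Lemma schreier_unconditional_subseq (K : numFieldType)
    (lad : omega1 -> nat -> omega1) (xi : omega1)
    (y : nat -> Cspace K (oexp omega (oexp omega xi))) :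
  ladder_system lad ->
  (forall t eps, 0 < eps ->
    exists N, forall n, (N <= n)%N -> `|Cspace_eval t (y n)| < eps) ->
  family_unconditional (schreier lad xi) y -> has_subseq (@unconditional _ _) y.
Proof.
move=> hlad y0 [ny by_ [C C0 yC]].
(* Singletons are Schreier sets and [y] is normalized, so unconditionality bounds each
   coefficient. *)
have ycb : coef_bound y C.
  move=> N a aN n; have := yC [fset n]%fset N a _ aN.
  rewrite big_seq_fset1 normrZ ny mulr1; apply.
  have -> : [fset m.+1 | m in [fset n]]%fset = [fset n.+1]%fset.
    by apply/fsetP => m; apply/imfsetP/fset1P => /= [[k /fset1P -> ->]//|->];
      exists n => //; exact/fset1P.
  exact: schreier_singleton.
have [s1 [hs1 s1P]] := pointwise_null_subseq y0.
(* Indices start at 0 while the Schreier families live on the positive integers; the shift also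
   ensures [k < e k]. *)
pose e k := (s1 k).+1.
pose U k := superlevel (y (s1 k)) (2^-1 ^+ k).
have half0 n : 0 < 2^-1 ^+ n :> K by rewrite exprn_gt0 // invr_gt0.
have [|||||M uM MP] := @schreier_intersections lad hlad e _ _ xi U _ _ _.
- by move=> m n mn; rewrite ltnS; exact: hs1.
- by move=> k; rewrite ltnS; exact: leq_increasing.
- by move=> n; apply: superlevel_closed; exact: gtr0_real.
- by move=> n _ [t [<- _]]; have /andP[] := valP (t : ordint _).
- move=> b; have [[t tb]|Nb] := pselect (exists
      t : ordint (oexp omega (oexp omega xi)), val t = b); last first.
    by exists 0%N => n _ [t [tb _]]; apply: Nb; exists t.
  have [j jP] := s1P t; exists j => k jk [u [ub uk]].
  have ut : u = t by apply: val_inj; rewrite /= ub tb.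
  by have := lt_le_trans (jP k jk) uk; rewrite ut ltxx.
have [|s2 [hs2 [n0 s20] s2S]] := @increasing_choice (fun _ _ m => M m).
  by move=> _ n; have [m] := uM n; exists m.
have s2M k : M (s2 k) by case: k.
pose s k := s1 (s2 k).
have hs : {homo s : m n / (m < n)%N} by move=> m n /hs2/hs1.
have zcb := coef_bound_subseq hs ycb.
exists s; split => //; split; first by move=> n; exact: ny.
  exact: basic_subseq hs C0 ycb by_.
(* One [C] for the first term with [t] in its superlevel set, one for the Schreier part, and two for
   the geometric remainder. *)
exists (C * 4); first by rewrite mulr_gt0.
move=> F N a _ aN; set w := \sum_(n < N) _.
have w0 : 0 <= C * `|w| by rewrite mulr_ge0 // ltW.
apply: Cspace_norm_le => [|t]; first by rewrite mulrAC mulr_ge0.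
rewrite Cspace_eval_sum (bigID (fun n => `[< U (s2 n) (val (t : ordint _)) >])) /=.
have -> : C * 4 * `|w| = (C * `|w| + C * `|w|) + C * `|w| * 2.
  by rewrite mulrAC -[4%N]/(2 + 2)%N natrD mulrDr mulr_natr mulr2n.
rewrite (le_trans (ler_normD _ _)) // lerD //; last first.
  apply: (@le_trans _ _ (\sum_(n <- F) C * `|w| * 2^-1 ^+ n)); last first.
    by rewrite -mulr_sumr ler_wpM2l // sum_geometric_le2 // fset_uniq.
  rewrite (le_trans (ler_norm_sum _ _ _)) // big_mkcond /= ler_sum // => n _.
  have half1 : 2^-1 ^+ s2 n <= 2^-1 ^+ n :> K.
    rewrite ler_wiXn2l ?invr_ge0 // ?leq_increasing //.
    by rewrite invf_le1 // ler1n.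
  case: asboolP => /= [_|NU]; first by rewrite mulr_ge0 // ltW.
  rewrite normrM ler_pM // ?zcb //; apply: le_trans half1.
  rewrite ltW // real_ltNge ?normr_real ?gtr0_real //.
  by apply/negP => h; apply: NU; exists t.
rewrite -big_filter; set P := (fun n => `[< _ >]).
have pA : perm_eq (sort leq [seq n <- F | P n]) [seq n <- F | P n].
  by rewrite perm_sort.
rewrite -(perm_big _ pA) /=.
have uA : uniq (sort leq [seq n <- F | P n]).
  by rewrite sort_uniq filter_uniq // fset_uniq.
have AP n : n \in sort leq [seq n <- F | P n] -> U (s2 n) (val (t : ordint _)).
  by rewrite mem_sort mem_filter => /andP[/asboolP].
have sA : sorted ltn (sort leq [seq n <- F | P n]).
  by rewrite ltn_sorted_uniq_leq uA sort_sorted //; exact: leq_total.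
case: (sort leq _) uA AP sA => [|m D] uA AP sA.
  by rewrite big_nil normr0 addr_ge0.
(* The first element [m] is estimated alone. The rest [D] is a Schreier set in the indices of [y],
   because the sets [U] along [m :: D] share the point [t]. *)
rewrite big_cons (le_trans (ler_normD _ _)) // lerD //.
  rewrite normrM -[leRHS]mulr1 ler_pM // ?zcb //.
  by rewrite (le_trans (Cspace_eval_le _ _)) // ny.
rewrite -Cspace_eval_sum (le_trans (Cspace_eval_le _ _)) //.
have /andP[_ uD] := uA.
apply: (family_bound_subseq (S := schreier lad xi) (s := s)) => //.
have -> : [seq (s k).+1 | k <- D] = map e (map s2 D) by rewrite -map_comp.
apply: (MP (s2 m)).
- by rewrite -[s2 m :: _]/(map s2 (m :: D)); exact: homo_sorted sA.
- by rewrite -[s2 m :: _]/(map s2 (m :: D)) => _ /mapP[k _ ->].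
- exists (val (t : ordint _)); rewrite -[s2 m :: _]/(map s2 (m :: D)).
  by move=> _ /mapP[k kA ->]; exact: AP.
Qed.

Theorem corollary3p8 (R : realType) (k : scalar_kind)
    (lad : omega1 -> nat -> omega1) (hlad : ladder_system lad) (xi : omega1)
    (x : nat -> Cspace (scalars R k) (oexp omega (oexp omega xi)))
    (hnorm : normalized x) (hnull : weakly_null x) :
  has_subseq (@unconditional _ _) x <->
  has_subseq (family_unconditional (schreier lad xi)) x.
Proof.
split=> -[s [hs]] => [[ns bs [C C0 sC]]|us].
  (* The family of [unconditional] is [setT], so its bound covers the Schreier sets. *)
  by exists s; split => //; split => //; exists C => // F N a _; exact: sC.
have [|s' [hs' us']] := schreier_unconditional_subseq hlad _ us.
  move=> t eps eps0; have [N NP] := weakly_null_eval t hnull eps0.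
  by exists N => n Nn; apply: NP; exact: leq_trans Nn (leq_increasing _ hs).
by exists (s \o s'); split => // m n /hs'/hs.
Qed.
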